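(* Let $T>0$ and let $h:\mathbb{R}^m\to\mathbb{R}^m$ be locally Lipschitz continuous with at most linear growth. Let $\phi:D([0,T],\mathbb{R}^m)\to D([0,T],\mathbb{R}^m)$ denote the mapping $x\mapsto y$ defined by the integral representation $$y(t)=x(t)+\int_0^th(y(s))\,ds,\qquad t\in[0,T].$$ Then $\phi$ is continuous when $D([0,T],\mathbb{R}^m)$ is endowed with the product $M_1$ topology.
   Context: $D([0,T],\mathbb{R}^m)$ is the space of $\mathbb{R}^m$-valued càdlàg functions on $[0,T]$. The product $M_1$ topology is the product, over the $m$ coordinates, of Skorokhod's $M_1$ topology on $D([0,T],\mathbb{R})$ (see Whitt, Stochastic-Process Limits). ''At most linear growth'' means $|h(x)|\le C(1+|x|)$ for some constant $C$ and all $x\in\mathbb{R}^m$. *)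

(* Defs.v *)
From HB Require Import structures.
From mathcomp Require Import all_boot all_order all_algebra.
From mathcomp Require Import all_classical all_reals all_analysis.

Set Implicit Arguments.
Unset Strict Implicit.
Unset Printing Implicit Defensive.

Import Order.TTheory GRing.Theory Num.Theory.
Import numFieldNormedType.Exports.

Local Open Scope classical_set_scope.
Local Open Scope ring_scope.

Section cadlag.
Context {R : realType}.

Definition is_cadlag (V : normedModType R) (T : R) (x : R -> V) : Prop :=
  (forall t, 0 <= t < T -> x s @[s --> t^'+] --> x t) /\
  (forall t, 0 < t <= T -> cvg (x s @[s --> t^'-])).

(* D([0, T], V).  A function on [0, T] is represented by its extension by 0 to
   the whole of R, so that Leibniz equality in [cadlag V T] is equality of
   functions on [0, T]. *)
Record cadlag (V : normedModType R) (T : R) := Cadlag {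
  cadlag_fun :> R -> V;
  cadlag_prop : is_cadlag T cadlag_fun;
  cadlag_out : forall t, t \notin `[0, T] -> cadlag_fun t = 0 }.

(* x(t-), with the usual convention x(0-) = x(0). *)
Definition left_limit (V : normedModType R) (T : R) (x : cadlag V T) (t : R) : V :=
  if t == 0 then x 0 else lim (x s @[s --> t^'-]).

HB.instance Definition _ (V : normedModType R) (T : R) :=
  gen_eqMixin (cadlag V T).
HB.instance Definition _ (V : normedModType R) (T : R) :=
  gen_choiceMixin (cadlag V T).

End cadlag.

Section M1.
Context {R : realType} (T : R).

(* D([0, T], R), to be endowed with the M1 topology. *)
Definition cadlagM1 : Type := cadlag R^o T.
HB.instance Definition _ := Choice.on cadlagM1.

Implicit Types x : cadlagM1.

(* Points of the completed graph are written (z, t): space first, then time. *)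
Definition completed_graph x : set (R * R) :=
  [set p | p.2 \in `[0, T] /\ exists2 a, a \in `[0, 1] &
     p.1 = a * left_limit x p.2 + (1 - a) * x p.2].

Definition graph_le x (p q : R * R) : Prop :=
  p.2 < q.2 \/
  p.2 = q.2 /\ `|left_limit x p.2 - p.1| <= `|left_limit x p.2 - q.1|.

(* (u, r) is a parametric representation of x: a continuous nondecreasing map
   from [0, 1] onto the completed graph.  Values outside [0, 1] are ignored. *)
Definition parametric_rep x (u r : R -> R) : Prop :=
  [/\ {within `[0, 1], continuous u},
      {within `[0, 1], continuous r},
      [set (u s, r s) | s in `[0, 1]] = completed_graph x &
      {in `[0, 1] &, forall s1 s2, s1 <= s2 ->
         graph_le x (u s1, r s1) (u s2, r s2)}].

Definition sup_dist (f g : R -> R) : \bar R :=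
  ereal_sup [set (`|f s - g s|)%:E | s in `[0, 1]].

Definition dist_M1 x1 x2 : \bar R :=
  ereal_inf [set d | exists u1 r1 u2 r2,
    [/\ parametric_rep x1 u1 r1, parametric_rep x2 u2 r2 &
        d = maxe (sup_dist u1 u2) (sup_dist r1 r2)]].

Definition open_M1 : set_system cadlagM1 :=
  [set U | forall x, U x ->
     exists2 e : R, 0 < e & [set y | (dist_M1 x y < e%:E)%E] `<=` U].

Let open_M1T : open_M1 setT.
Proof. by move=> x _; exists 1. Qed.

Let open_M1I : setI_closed open_M1.
Proof.
move=> A B oA oB x [/oA[e e0 eA] /oB[f f0 fB]].
exists (Num.min e f); first by rewrite lt_min e0.
move=> y /= xy; split; [apply: eA|apply: fB]; apply: (lt_le_trans xy).
  by rewrite lee_fin ge_min lexx.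
by rewrite lee_fin ge_min lexx orbT.
Qed.

Let open_M1_bigcup (I : Type) (f : I -> set cadlagM1) :
  (forall i, open_M1 (f i)) -> open_M1 (\bigcup_i f i).
Proof.
move=> of_ x [i _ /of_[e e0 ef]]; exists e => //.
by move=> y /ef fy; exists i.
Qed.

HB.instance Definition _ :=
  isOpenTopological.Build cadlagM1 open_M1T open_M1I open_M1_bigcup.

End M1.

Section product_M1.
Context {R : realType} (m : nat) (T : R).

(* D([0, T], R^m), to be endowed with the product M1 topology. *)
Definition cadlag_prodM1 : Type := cadlag 'rV[R]_m T.
HB.instance Definition _ := Choice.on cadlag_prodM1.

Lemma is_cadlag_coord (x : R -> 'rV[R]_m) (i : 'I_m) :
  is_cadlag T x -> @is_cadlag R R^o T (fun t => x t 0 i).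
Proof.
move=> [xr xl]; split => t tT.
  exact: (cvg_comp _ _ (xr t tT) (@coord_continuous _ _ _ 0 i (x t))).
apply/cvg_ex; exists (lim (x s @[s --> t^'-]) 0 i).
exact: (cvg_comp _ _ (xl t tT) (@coord_continuous _ _ _ 0 i _)).
Qed.

Lemma coord_out (x : cadlag 'rV[R]_m T) (i : 'I_m) t :
  t \notin `[0, T] -> x t 0 i = 0.
Proof. by move=> /cadlag_out ->; rewrite mxE. Qed.

Definition coord_path (x : cadlag 'rV[R]_m T) (i : 'I_m) : cadlagM1 T :=
  Cadlag (is_cadlag_coord i (cadlag_prop x)) (@coord_out x i).

Definition coord_paths (x : cadlag_prodM1) :
  prod_topology (fun _ : 'I_m => cadlagM1 T) := coord_path x.

HB.instance Definition _ :=
  Topological.copy cadlag_prodM1 (initial_topology coord_paths).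

End product_M1.
Arguments cadlag_prodM1 {R} m T.

(* Main.v *)
Require Import Defs.
From HB Require Import structures.
From mathcomp Require Import all_boot all_order all_algebra.
From mathcomp Require Import all_classical all_reals all_analysis.
From mathcomp Require Import measurable_realfun ring lra.

Set Implicit Arguments.
Unset Strict Implicit.
Unset Printing Implicit Defensive.

Import Order.TTheory GRing.Theory Num.Theory.
Import numFieldNormedType.Exports.

Local Open Scope classical_set_scope.
Local Open Scope ring_scope.

(** The equation y = x + int h(y) is solved pathwise. The growth bound and
    Gronwall's inequality confine every solution to a ball that depends only on a
    bound of [x], and on this ball the locally Lipschitz function [h] is
    Lipschitz; hence [h] may be replaced by a bounded globally Lipschitz function,
    for which Picard iteration converges ([picard], [solution_exists]), and
    Gronwall's inequality gives uniqueness and stability: if y = x + g and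
    y' = x' + g', then sup |g - g'| is bounded by a constant times the L^1
    distance of [x] and [x'] ([solution_stability]).

    The term g is a Lipschitz function of time, and adding it to [x] only shears
    the completed graph: a parametric representation (u, r) of the i-th
    coordinate of [x] yields the representation (u + g_i o r, r) of the i-th
    coordinate of [y] ([parametric_rep_add]). Therefore, coordinate by coordinate,
    the M1 distance of [y] and [y'] is at most d + B d + sup |g - g'|, where d is
    the M1 distance of [x] and [x'] in that coordinate and B is the Lipschitz
    constant of g ([dist_M1_add]). This is the point at which the product topology
    suffices: the coordinates of [x] and [x'] may be matched by different
    representations, because they only interact through g. As M1 convergence
    implies L^1 convergence ([dist_M1_L1], by dominated convergence, the paths
    having countably many jumps), sup |g - g'| is small when [x'] is close to [x],
    and continuity follows.

    The M1 topology is defined by requiring open sets to contain an M1 ball around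
    each of their points, so that balls are neighbourhoods of their centres
    ([nbhs_ball_M1]) only thanks to two further facts. First, every cadlag path
    has a parametric representation ([parametric_rep_exists]): the points (z, t)
    of the completed graph are indexed by the pairs (t, th) of [0, T] * [0, 1] in
    lexicographic order, a clock [L] on these pairs is constructed that increases
    strictly along the graph ([clock_exists]), and the generalized inverse of [L]
    is the desired representation. Second, the M1 distance satisfies the triangle
    inequality ([dist_M1_triangle]): any two representations of the same path
    become uniformly close after a change of parameter in one of them
    ([rep_equiv]). *)

(** * Right-continuous and cadlag functions *)

Section right_continuity.
Context {R : realType} {V : normedModType R} (T : R).

(** Right continuity on [0, T[. *)
Definition rcont (z : R -> V) : Prop :=
  forall t, 0 <= t < T -> z s @[s --> t^'+] --> z t.

Lemma rcont_eps (z : R -> V) t : rcont z -> 0 <= t < T -> forall e, 0 < e ->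
  exists2 d, 0 < d & forall s, t <= s < t + d -> `|z s - z t| < e.
Proof.
move=> zr tT e e0; move: (zr _ tT).
move/cvgrPdist_lt => /(_ _ e0) [d /= d0 dP]; exists d => // s /andP[ts std].
have [->|st] := eqVneq s t; first by rewrite subrr normr0.
rewrite distrC; apply: dP => /=; last by rewrite lt_neqAle eq_sym st ts.
by rewrite ltr0_norm; lra.
Qed.

Lemma rcontD (z w : R -> V) : rcont z -> rcont w -> rcont (fun s => z s + w s).
Proof. by move=> zr wr t tT; apply: cvgD; [exact: zr|exact: wr]. Qed.

Lemma rcontB (z w : R -> V) : rcont z -> rcont w -> rcont (fun s => z s - w s).
Proof. by move=> zr wr t tT; apply: cvgB; [exact: zr|exact: wr]. Qed.

(** Lipschitz continuity on [0, T], with constant [B]. *)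
Definition lipT (B : R) (z : R -> V) : Prop :=
  forall s t, 0 <= s <= T -> 0 <= t <= T -> `|z s - z t| <= B * `|s - t|.

Lemma lipT_rcont B z : lipT B z -> rcont z.
Proof.
move=> zB t tT; apply/cvgrPdist_lt => e e0; near=> s.
have st : t < s by near: s; exact: nbhs_right_gt.
have sT : s < T by near: s; apply: nbhs_right_lt; lra.
have sd : s < t + e / (`|B| + 1).
  by near: s; apply: nbhs_right_lt; rewrite ltrDl divr_gt0// ltr_wpDl.
apply: (@le_lt_trans _ _ (`|B| * `|t - s|)).
  apply: (le_trans (zB _ _ _ _)); [lra|lra|].
  by rewrite ler_wpM2r// ler_norm.
have B1 : 0 < `|B| + 1 by rewrite ltr_wpDl.
have : (s - t) * (`|B| + 1) < e by rewrite -ltr_pdivlMr//; lra.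
have -> : `|t - s| = s - t by rewrite distrC gtr0_norm//; lra.
rewrite mulrDr mulr1 mulrC; lra.
Unshelve. all: by end_near. Qed.

(** The class of integrands: functions that are right-continuous on [0, T[ and
    bounded on [0, T]. *)
Definition rcb (z : R -> V) : Prop :=
  rcont z /\ exists M : R, forall t, 0 <= t <= T -> `|z t| <= M.

Lemma rcbD (z w : R -> V) : rcb z -> rcb w -> rcb (fun t => z t + w t).
Proof.
move=> [zr [M zM]] [wr [N wN]]; split; first exact: rcontD.
exists (M + N) => t tT; apply: (le_trans (ler_normD _ _)).
by apply: lerD; [exact: zM|exact: wN].
Qed.

Lemma rcbB (z w : R -> V) : rcb z -> rcb w -> rcb (fun t => z t - w t).
Proof.
move=> [zr [M zM]] [wr [N wN]]; split; first exact: rcontB.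
exists (M + N) => t tT; apply: (le_trans (ler_normB _ _)).
by apply: lerD; [exact: zM|exact: wN].
Qed.

Lemma rcb_cst (c : V) : rcb (fun=> c).
Proof. by split; [move=> t _; exact: cvg_cst|exists `|c|]. Qed.

Lemma lipT_rcb B z : 0 < T -> lipT B z -> rcb z.
Proof.
move=> T0 zB; split; first exact: lipT_rcont zB.
exists (`|z 0| + `|B| * T) => t tT.
have tT0 : 0 <= (0 : R) <= T by rewrite lexx ltW.
have := zB _ _ tT tT0; rewrite subr0 ger0_norm; last by case/andP: tT.
have : B * t <= `|B| * T.
  by apply: (@le_trans _ _ (`|B| * t)); [rewrite ler_wpM2r ?ler_norm|rewrite ler_wpM2l]; case/andP: tT.
have := ler_normD (z t - z 0) (z 0); rewrite subrK; lra.
Qed.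

End right_continuity.

Lemma rcb_norm {R : realType} {V : normedModType R} (T : R) (z : R -> V) :
  rcb T z -> @rcb R R^o T (fun t => `|z t|).
Proof.
move=> [zr [M zM]]; split; last by exists M => t tT; rewrite normr_id zM.
by move=> t tT; apply: cvg_norm; exact: zr.
Qed.

Lemma rcb_comp {R : realType} {V W : normedModType R} (T : R) (F : V -> W) (C : R)
    (z : R -> V) : continuous F -> 0 <= C ->
  (forall v, `|F v| <= C * (1 + `|v|)) -> rcb T z -> rcb T (F \o z).
Proof.
move=> Fc C0 FC [zr [M zM]]; split.
  by move=> t tT; exact: (cvg_comp _ _ (zr t tT) (Fc (z t))).
exists (C * (1 + M)) => t tT; apply: (le_trans (FC _)).
by rewrite ler_wpM2l// lerD2l zM.
Qed.

Section cadlag_theory.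
Context {R : realType} {V : normedModType R} (T : R).
Implicit Types (x : cadlag V T) (t s e : R).

Lemma cadlag_right x t : 0 <= t < T -> forall e, 0 < e ->
  exists2 d, 0 < d & forall s, t <= s < t + d -> `|x s - x t| < e.
Proof. by apply: rcont_eps; have [] := cadlag_prop x. Qed.

Lemma cadlag_left x t : 0 < t <= T -> forall e, 0 < e ->
  exists2 d, 0 < d <= t & forall s, t - d < s < t -> `|x s - left_limit x t| < e.
Proof.
move=> tT e e0; have [_ /(_ _ tT) xl] := cadlag_prop x.
have {xl} : x s @[s --> t^'-] --> left_limit x t.
  by rewrite /left_limit gt_eqF//; case/andP: tT.
move/cvgrPdist_lt => /(_ _ e0) [d /= d0 dP].
exists (Num.min d t); first by rewrite ge_min lexx orbT lt_min d0 !andbT; case/andP: tT.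
move=> s /andP[ts st]; rewrite distrC; apply: dP => //=.
have : Num.min d t <= d by rewrite ge_min lexx.
by rewrite gtr0_norm; lra.
Qed.

(** Closed balls are stable under left limits. *)
Lemma left_limit_le x t (c : V) a e : 0 <= a < t -> t <= T ->
  (forall s, a < s < t -> `|x s - c| <= e) -> `|left_limit x t - c| <= e.
Proof.
move=> /andP[a0 at_] tT xP; apply/ler_addgt0Pr => f f0.
have [|d /andP[d0 dt] dP] := cadlag_left x (t := t) _ f0; first lra.
pose s := Num.max ((a + t) / 2) (t - d / 2).
have sa : a < s by rewrite lt_max; apply/orP; left; lra.
have sd : t - d < s by rewrite lt_max; apply/orP; right; lra.
have st : s < t by rewrite gt_max; apply/andP; split; lra.
have -> : left_limit x t - c = (x s - c) - (x s - left_limit x t).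
  by rewrite opprB [RHS]addrC addrA subrK.
apply: (le_trans (ler_normB _ _)); apply: lerD; first by apply: xP; rewrite sa.
by apply: ltW; apply: dP; rewrite sd.
Qed.

Lemma left_limit0 x : left_limit x 0 = x 0.
Proof. by rewrite /left_limit eqxx. Qed.

(** By compactness of [0, T], as the one-sided limits bound the path near each
    point. *)
Lemma cadlag_bounded x : exists2 M, 0 < M & forall t, 0 <= t <= T -> `|x t| <= M.
Proof.
have loc : forall t, `[0, T]%classic t -> \forall t' \near t & M \near +oo,
    0 <= t' <= T -> `|x t'| <= M.
  move=> t; rewrite /= in_itv /= => tT.
  have [d1 d10 d1P] : exists2 d, 0 < d & forall s, 0 <= s <= T -> t <= s < t + d ->
      `|x s - x t| < 1.
    have [tT'|tT'] := ltP t T.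
      have [|d d0 dP] := @cadlag_right x t _ 1 ltr01; first lra.
      by exists d => // s _; exact: dP.
    exists 1 => // s sT ts; have -> : s = t by lra.
    by rewrite subrr normr0.
  have [d2 d20 d2P] : exists2 d, 0 < d & forall s, 0 <= s <= T -> t - d < s < t ->
      `|x s - left_limit x t| < 1.
    have [t0|t0] := ltP 0 t.
      have [|d /andP[d0 _] dP] := @cadlag_left x t _ 1 ltr01; first lra.
      by exists d => // s _; exact: dP.
    by exists 1 => // s sT ts; exfalso; lra.
  exists ([set s | `|t - s| < Num.min d1 d2],
          [set M | `|x t| + `|left_limit x t| + 1 < M]) => /=.
    split; first by exists (Num.min d1 d2) => //=; rewrite lt_min d10.
    exists (`|x t| + `|left_limit x t| + 1).
    by split => //; rewrite realE addr_ge0.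
  move=> [s M] /= [/=]; rewrite lt_min ltr_norml ltr_norml => /andP[sd1 sd2] MP sT.
  apply: le_trans (ltW MP).
  have n1 := normr_ge0 (x t); have n2 := normr_ge0 (left_limit x t).
  have [ts|st] := leP t s.
    have xs : `|x s - x t| < 1 by apply: d1P => //; lra.
    have := ler_normD (x s - x t) (x t); rewrite subrK; lra.
  have xs : `|x s - left_limit x t| < 1 by apply: d2P => //; lra.
  have := ler_normD (x s - left_limit x t) (left_limit x t); rewrite subrK; lra.
have /compact_near_coveringP := @segment_compact R 0 T.
move=> /(_ R +oo (fun M t => 0 <= t <= T -> `|x t| <= M) _ loc) [M [_ MP]].
exists (Num.max M 0 + 1); first by rewrite ltr_wpDl// le_max lexx orbT.
move=> t tT; apply: (MP (Num.max M 0 + 1)) => //.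
  by rewrite ltr_pwDr// le_max lexx.
Qed.

Lemma cadlag_rcb x : rcb T x.
Proof.
split; first by have [] := cadlag_prop x.
by have [M M0 xM] := cadlag_bounded x; exists M.
Qed.

End cadlag_theory.

Section cadlag_add.
Context {R : realType} {V : normedModType R} (T : R).

Lemma lipT_left B (g : R -> V) t : lipT T B g -> 0 < t <= T ->
  g s @[s --> t^'-] --> g t.
Proof.
move=> gB tT; apply/cvgrPdist_lt => e e0; near=> s.
have st : s < t by near: s; exact: nbhs_left_lt.
have s0 : 0 < s by near: s; apply: nbhs_left_gt; lra.
have B1 : 0 < `|B| + 1 by rewrite ltr_wpDl.
have sd : t - e / (`|B| + 1) < s.
  by near: s; apply: nbhs_left_gt; rewrite gtrBl divr_gt0.
apply: (@le_lt_trans _ _ (`|B| * `|t - s|)).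
  apply: (le_trans (gB _ _ _ _)); [lra|lra|].
  by rewrite ler_wpM2r// ler_norm.
have : (t - s) * (`|B| + 1) < e by rewrite -ltr_pdivlMr//; lra.
have -> : `|t - s| = t - s by rewrite gtr0_norm//; lra.
rewrite mulrDr mulr1 mulrC; lra.
Unshelve. all: by end_near. Qed.

(** The sum is set to 0 outside [0, T], as the type of cadlag paths requires. *)
Lemma cadlag_add_lip B (x : cadlag V T) (g : R -> V) : lipT T B g ->
  exists y : cadlag V T, forall t, 0 <= t <= T -> y t = x t + g t.
Proof.
move=> gB.
pose y t : V := if t \in `[0, T] then x t + g t else 0.
have yE t : 0 <= t <= T -> y t = x t + g t by move=> tT; rewrite /y in_itv/= tT.
have [xr xl] := cadlag_prop x.
have yc : is_cadlag T y.
  split => t tT.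
    rewrite yE; last by lra.
    apply: cvg_trans (cvgD (xr _ tT) (lipT_rcont gB tT)).
    apply: near_eq_cvg; near=> s; apply/esym; apply: yE.
    have st : t < s by near: s; exact: nbhs_right_gt.
    have sT : s < T by near: s; apply: nbhs_right_lt; lra.
    lra.
  apply/cvg_ex; exists (lim (x s @[s --> t^'-]) + g t).
  apply: cvg_trans (cvgD (xl _ tT) (lipT_left gB tT)).
  apply: near_eq_cvg; near=> s; apply/esym; apply: yE.
  have st : s < t by near: s; exact: nbhs_left_lt.
  have s0 : 0 < s by near: s; apply: nbhs_left_gt; lra.
  lra.
have yo t : t \notin `[0, T] -> y t = 0 by move=> /negbTE tT; rewrite /y tT.
by exists (Cadlag yc yo).
Unshelve. all: by end_near. Qed.

Lemma left_limit_add B (x y : cadlag V T) (g : R -> V) t : lipT T B g ->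
  (forall t, 0 <= t <= T -> y t = x t + g t) -> 0 <= t <= T ->
  left_limit y t = left_limit x t + g t.
Proof.
move=> gB yE tT; rewrite /left_limit; case: eqVneq => [->|t0].
  by apply: yE; lra.
have tT' : 0 < t <= T by rewrite lt_neqAle eq_sym t0; lra.
have [_ xl] := cadlag_prop x.
apply: cvg_lim => //; apply: cvg_trans (cvgD (xl _ tT') (lipT_left gB tT')).
apply: near_eq_cvg; near=> s; apply/esym; apply: yE.
have st : s < t by near: s; exact: nbhs_left_lt.
have s0 : 0 < s by near: s; apply: nbhs_left_gt; lra.
lra.
Unshelve. all: by end_near. Qed.

Lemma cadlag_eq (x y : cadlag V T) :
  (forall t, 0 <= t <= T -> x t = y t) -> x = y.
Proof.
move=> xy; have : cadlag_fun x = cadlag_fun y.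
  apply/funext => t; have [tT|tT] := boolP (t \in `[0, T]).
    by apply: xy; move: tT; rewrite in_itv.
  by rewrite !cadlag_out.
case: x y {xy} => [x xc xo] [y yc yo] /= xy; subst y.
by congr Cadlag; exact: Prop_irrelevance.
Qed.

End cadlag_add.

(** * Integrals of right-continuous functions and Gronwall's inequality *)
Section integration.
Context {R : realType} (T : R).
Local Notation rcbR := (@rcb R R^o T).
Local Notation mu := (@lebesgue_measure R).

(** A right-continuous function is the pointwise limit of its step approximations
    at the next point of the grid of mesh 1/(n + 1). *)
Lemma rcont_measurable (f : R -> R) : 0 < T -> @rcont R R^o T f ->
  measurable_fun `[0, T] f.
Proof.
move=> T0 fr.
pose N (n : nat) (t : R) : R :=
  Num.min T ((Num.trunc (t * n.+1%:R)).+1%:R / n.+1%:R).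
apply: (@measurable_realfun.measurable_fun_cvg _ _ _ _ (fun n => f \o N n)).
  move=> n.
  pose E k : set R := `[0, T] `&` `[k%:R / n.+1%:R, k.+1%:R / n.+1%:R[.
  have n0 : 0 < n.+1%:R :> R by rewrite ltr0n.
  have -> : `[0, T]%classic = \bigcup_k E k.
    apply/seteqP; split => [t /= tT|t [k _] []//].
    exists (Num.trunc (t * n.+1%:R)) => //; split => //=.
    move: tT; rewrite !in_itv/= => /andP[t0 _].
    rewrite ler_pdivrMr// ltr_pdivlMr// truncn_itv//.
    by rewrite mulr_ge0.
  have mE k : measurable (E k) by apply: measurableI; exact: measurable_itv.
  apply/measurable_fun_bigcup => // k.
  have NE : {in E k, (fun=> f (Num.min T (k.+1%:R / n.+1%:R))) =1 f \o N n}.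
    move=> t; rewrite inE => -[_ /=].
    rewrite in_itv/= ler_pdivrMr// ltr_pdivlMr// => tk.
    by rewrite /N (truncn_def tk).
  by apply: (eq_measurable_fun _ NE); exact: measurable_cst.
move=> t; rewrite /= in_itv/= => /andP[t0 tT].
have [tT'|Tt] := ltP t T; last first.
  have -> : t = T by lra.
  have -> : (fun n => (f \o N n) T) = fun=> f T.
    apply/funext => n /=; congr f; rewrite /N min_l//.
    by rewrite ler_pdivlMr ?ltr0n// ltW// truncnS_gt.
  exact: cvg_cst.
apply/cvgrPdist_lt => e e0.
have tT2 : 0 <= t < T by rewrite t0.
have [d d0 dP] := rcont_eps fr tT2 e0.
near=> n; rewrite distrC; apply: dP.
have n0 : 0 < n.+1%:R :> R by rewrite ltr0n.
have tn0 : 0 <= t * n.+1%:R by rewrite mulr_ge0.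
rewrite /N le_min tT /= ler_pdivlMr// ltW ?truncnS_gt//=.
rewrite gt_min; apply/orP; right; rewrite ltr_pdivrMr//.
have /andP[+ _] := truncn_itv tn0.
rewrite -[X in X < _]natr1 mulrDl => kt.
apply: (le_lt_trans (lerD kt (lexx 1))); rewrite ltrD2l -ltr_pdivrMl// mulr1.
near: n; have := near_infty_natSinv_lt (PosNum d0).
by apply: filterS => n /=; rewrite invf_plt ?posrE ?ltr0n.
Unshelve. all: by end_near. Qed.

Hypothesis T0 : 0 < T.

Lemma Rintegral_cst_itv (c a b : R) : a <= b ->
  \int[mu]_(s in `[a, b]) c = c * (b - a).
Proof.
move=> ab; transitivity (c * fine (mu `[a, b]%classic)).
  exact: Rintegral_cst.
congr (_ * _); rewrite lebesgue_measure_itv/= lte_fin -EFinB; case: ltP => //= ba.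
by have -> : b = a; [exact/le_anti/andP|rewrite subrr].
Qed.

Lemma rcb_integrable f a b : rcbR f -> 0 <= a -> b <= T ->
  mu.-integrable `[a, b] (EFin \o f).
Proof.
move=> [fr [M fM]] a0 bT; apply: (@integrableS _ _ _ mu (`[0, T]%classic : set R)) => //.
  by apply: subset_itv; rewrite bnd_simp.
apply: measurable_bounded_integrable => //.
- exact: (compact_finite_measure (@segment_compact R 0 T)).
- exact: rcont_measurable.
- exists M; split => [|M' MM' t]; first exact: num_real.
  by rewrite /= in_itv/= => tT; apply: (le_trans (fM _ tT)); exact: ltW.
Qed.

Lemma Rintegral_le_rcb f g t : rcbR f -> rcbR g -> t <= T ->
  (forall s, 0 <= s <= t -> f s <= g s) ->
  \int[mu]_(s in `[0, t]) f s <= \int[mu]_(s in `[0, t]) g s.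
Proof.
move=> fr gr tT fg; apply: le_Rintegral => //; exact: rcb_integrable.
Qed.

Lemma Rintegral_norm_le f g a b : rcbR f -> rcbR g -> 0 <= a -> b <= T ->
  (forall s, a <= s <= b -> `|f s| <= g s) ->
  `|\int[mu]_(s in `[a, b]) f s| <= \int[mu]_(s in `[a, b]) g s.
Proof.
move=> fr gr a0 bT fg; have fi := rcb_integrable fr a0 bT.
apply: (le_trans (le_normr_Rintegral _ _)) => //.
apply: le_Rintegral => //.
- exact: integrable_norm fi.
- exact: rcb_integrable.
Qed.

Lemma rcbZ k f : rcbR f -> rcbR (fun s => k * f s).
Proof.
move=> [fr [M fM]]; split.
  by move=> t tT; apply: (@cvgZr _ R^o); exact: fr.
by exists (`|k| * M) => t tT; rewrite normrM ler_wpM2l// fM.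
Qed.

Lemma rcb_continuous (f : R -> R) : continuous f -> rcbR f.
Proof.
move=> fc; split.
  by move=> t _; apply: cvg_within_filter; exact: fc.
have /compact_bounded [M [_ MP]] : compact (f @` `[0, T]).
  apply: continuous_compact; last exact: segment_compact.
  exact: continuous_subspaceT.
exists (M + 1) => t tT; apply: (MP (M + 1)); first by rewrite ltrDl.
by exists t => //; rewrite /= in_itv.
Qed.

Lemma Rintegral_sub f a b : rcbR f -> 0 <= a <= b -> b <= T ->
  \int[mu]_(s in `[0, b]) f s - \int[mu]_(s in `[0, a]) f s =
  \int[mu]_(s in `[a, b]) f s.
Proof.
move=> fr /andP[a0 ab] bT.
rewrite (@Rintegral_itvB _ f (BLeft 0) (BRight b) a)//.
- apply: Rintegral_itv_obnd_cbnd.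
  apply: (@integrableS _ _ _ mu `[a, b]%classic) => //.
    by apply: subset_itvr; rewrite bnd_simp.
  exact: rcb_integrable.
- exact: rcb_integrable.
Qed.

Lemma Rintegral_lip f B a b : rcbR f -> (forall s, 0 <= s <= T -> `|f s| <= B) ->
  0 <= a <= T -> 0 <= b <= T ->
  `|\int[mu]_(s in `[0, a]) f s - \int[mu]_(s in `[0, b]) f s| <= B * `|a - b|.
Proof.
move=> fr fB; wlog ab : a b / b <= a => [hw|] aT bT.
  have [/hw|/ltW/hw] := leP b a; first exact.
  by rewrite distrC (distrC a); apply.
rewrite Rintegral_sub//; [|lra|lra].
apply: (@le_trans _ _ (\int[mu]_(s in `[b, a]) B)).
  by apply: Rintegral_norm_le => //; [exact: rcb_cst|lra|lra|move=> s ?; apply: fB; lra].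
by rewrite Rintegral_cst_itv// ger0_norm// subr_ge0.
Qed.

End integration.

Section gronwall.
Context {R : realType} (T : R).
Local Notation rcbR := (@rcb R R^o T).
Hypothesis T0 : 0 < T.
Local Notation mu := (@lebesgue_measure R).

Let continuous_expM (K : R) : continuous (fun s : R => expR (2 * K * s)).
Proof.
move=> s; apply: continuous_comp; last exact: continuous_expR.
exact: mulrl_continuous.
Qed.

Lemma rcb_expM (K : R) : rcbR (fun s : R => expR (2 * K * s)).
Proof. exact/rcb_continuous/continuous_expM. Qed.

Lemma Rintegral_expM (K t : R) : 0 < K -> 0 <= t ->
  K * \int[mu]_(s in `[0, t]) expR (2 * K * s) <= expR (2 * K * t) / 2.
Proof.
move=> K0; rewrite le_eqVlt => /predU1P[<-|t0].
  by rewrite set_itv1 Rintegral_set1 mulr0 divr_ge0// expR_ge0.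
pose F (s : R) : R := (2 * K)^-1 * expR (2 * K * s).
have K2 : 2 * K != 0 by rewrite mulf_neq0// gt_eqF.
have Fd (s : R) : is_derive s (1 : R) F (expR (2 * K * s)).
  have e1 : is_derive s (1 : R) (fun s : R => 2 * K * s) (2 * K).
    have := @is_deriveZ R R^o R^o id (2 * K) s (1 : R) 1 _.
    by rewrite /GRing.scale/= mulr1; apply; exact: is_derive_id.
  have e2 := is_derive1_comp (is_derive_expR (2 * K * s)) e1.
  apply: (is_derive_eq (@is_deriveZ R R^o R^o _ (2 * K)^-1 _ _ _ e2)).
  by rewrite /GRing.scale/= mulrCA mulVf// mulr1.
have Fc : continuous F.
  move=> s; apply: differentiable_continuous; apply/derivable1_diffP.
  by have [] := Fd s.
rewrite /Rintegral (@continuous_FTC2 _ _ F)//.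
- rewrite -EFinB /= /F mulr0 expR0 mulr1 mulrBr mulrA.
  have -> : K * (2 * K)^-1 = 2^-1 by rewrite invfM mulrCA mulfV ?mulr1// gt_eqF.
  by rewrite mulrC gerBl invr_ge0.
- by apply: continuous_subspaceT; exact: continuous_expM.
- split => [s _||]; first by have [] := Fd s.
  + by apply: cvg_within_filter; exact: Fc.
  + by apply: cvg_within_filter; exact: Fc.
- by move=> s _; rewrite derive1E; apply: derive_val.
Qed.

(** No differential inequality is needed: if [c] is the least upper bound of
    f t / exp (2 K t), inserting f <= c exp (2 K .) in the hypothesis gives
    c <= a + c / 2. *)
Lemma gronwall (f : R -> R) a K : rcbR f -> 0 < K -> 0 <= a ->
  (forall t, 0 <= t <= T -> f t <= a + K * \int[mu]_(s in `[0, t]) f s) ->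
  forall t, 0 <= t <= T -> f t <= 2 * a * expR (2 * K * t).
Proof.
move=> fr K0 a0 fP.
pose S := [set f t / expR (2 * K * t) | t in `[0, T]%classic].
have S0 : S !=set0 by exists (f 0 / expR (2 * K * 0)), 0 => //=; rewrite in_itv/= lexx ltW.
have [M fM] := fr.2.
have Sub : has_ubound S.
  exists M => _ [t /= + <-]; rewrite in_itv/= => tT.
  rewrite ler_pdivrMr ?expR_gt0//.
  have M0 : 0 <= M by apply: le_trans (fM _ tT).
  apply: (le_trans (ler_norm _)); apply: (le_trans (fM _ tT)).
  by rewrite ler_peMr// -expR0 ler_expR !mulr_ge0//; [lra|case/andP: tT].
pose c := Num.max (sup S) 0.
have c0 : 0 <= c by rewrite le_max lexx orbT.
have fc t : 0 <= t <= T -> f t <= c * expR (2 * K * t).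
  move=> tT; rewrite -ler_pdivrMr ?expR_gt0// le_max; apply/orP; left.
  by apply: ub_le_sup => //; exists t => //=; rewrite in_itv.
have cle : c <= 2 * a.
  have [Sn|Sp] := leP (sup S) 0.
    by rewrite /c max_r// mulr_ge0.
  suff : sup S <= a + c / 2 by rewrite /c max_l ?(ltW Sp)//; lra.
  apply: ge_sup => // _ [t /= + <-]; rewrite in_itv/= => tT.
  have [t0 tT'] := andP tT.
  rewrite ler_pdivrMr ?expR_gt0//; apply: (le_trans (fP _ tT)).
  rewrite mulrDl; apply: lerD.
    by rewrite ler_peMr// -expR0 ler_expR !mulr_ge0//; lra.
  apply: (@le_trans _ _ (c * (K * \int[mu]_(s in `[0, t]) expR (2 * K * s)))).
    rewrite mulrCA ler_wpM2l ?(ltW K0)// -RintegralZl//; last first.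
      by apply: (rcb_integrable T0) => //; exact: rcb_expM.
    apply: (Rintegral_le_rcb T0 fr) => //; first by apply: rcbZ; exact: rcb_expM.
    by move=> s /andP[s0 st]; apply: fc; lra.
  by rewrite -[leRHS]mulrA (mulrC 2^-1) ler_wpM2l// Rintegral_expM.
move=> t tT; apply: (le_trans (fc _ tT)).
by rewrite ler_wpM2r// expR_ge0.
Qed.

End gronwall.

(** * The integral equation *)
Section row_norm.
Context {R : realType} {m : nat}.
Implicit Types v : 'rV[R]_m.

Lemma rV_norm_le v c : 0 <= c -> (forall i, `|v 0 i| <= c) -> `|v| <= c.
Proof.
move=> c0 vc; rewrite [leLHS]/Num.Def.normr/= mx_normrE; apply: bigmax_le => // -[i j] _ /=.
by rewrite ord1.
Qed.

Lemma rV_coord_le v i : `|v 0 i| <= `|v|.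
Proof.
rewrite [leRHS]/Num.Def.normr/= mx_normrE.
by apply/bigmax_geP; right; exists (0, i).
Qed.

End row_norm.

(** A sequence with geometrically small steps converges, with a rate. *)
Lemma dyadic_cauchy {R : realType} (u : R^nat) (c : R) : 0 <= c ->
  (forall n, `|u n.+1 - u n| <= c / 2 ^+ n) ->
  exists l, forall n, `|u n - l| <= 2 * c / 2 ^+ n.
Proof.
move=> c0 uc; pose r n := 2 * c / 2 ^+ n.
have rS n : r n = 2 * r n.+1.
  by rewrite /r exprS invfM; field; rewrite expf_neq0.
have cr n : c / 2 ^+ n = r n.+1 by rewrite /r exprS invfM; field; rewrite expf_neq0.
have r0 n : 0 <= r n by rewrite divr_ge0 ?mulr_ge0 ?exprn_ge0.
have lo n k : u n - r n <= u (n + k)%N - r (n + k)%N.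
  elim: k => [|k IH]; first by rewrite addn0.
  apply: (le_trans IH); have := uc (n + k)%N.
  rewrite cr addnS ler_norml (rS (n + k)%N) => /andP[? _]; lra.
have hi n k : u (n + k)%N + r (n + k)%N <= u n + r n.
  elim: k => [|k IH]; first by rewrite addn0.
  apply: le_trans IH; have := uc (n + k)%N.
  rewrite cr addnS ler_norml (rS (n + k)%N) => /andP[_ ?]; lra.
have lohi n k : u n - r n <= u k + r k.
  apply: (le_trans (lo n k)); rewrite addnC.
  by apply: le_trans (hi k n); rewrite lerD2l (le_trans _ (r0 _))// oppr_le0.
pose S := range (fun n => u n - r n).
have Sub n : ubound S (u n + r n) by move=> _ [k _ <-].
exists (sup S) => n; rewrite ler_norml.
have up : u n - r n <= sup S.
  by apply: ub_le_sup; [exists (u 0%N + r 0%N); exact: Sub|exists n].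
have down : sup S <= u n + r n.
  by apply: ge_sup => //; exists (u 0%N - r 0%N), 0%N.
rewrite -/(r n); apply/andP; split; lra.
Qed.

Section vector_integral.
Context {R : realType} {m : nat} (T : R).
Local Notation rcbR := (@rcb R R^o T).
Hypothesis T0 : 0 < T.
Local Notation mu := (@lebesgue_measure R).
Implicit Types z w : R -> 'rV[R]_m.

(** The componentwise integral of a vector-valued function over [0, t]. *)
Definition vint z (t : R) : 'rV[R]_m := \row_i \int[mu]_(s in `[0, t]) z s 0 i.

Lemma rcb_coord z i : rcb T z -> rcbR (fun t => z t 0 i).
Proof.
move=> [zr [M zM]]; split; last first.
  by exists M => t tT; apply: le_trans (zM _ tT); exact: rV_coord_le.
by move=> t tT; exact: (cvg_comp _ _ (zr t tT) (@coord_continuous _ _ _ 0 i (z t))).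
Qed.

Lemma vint_le z w f t : rcb T z -> rcb T w -> rcbR f -> 0 <= t <= T ->
  (forall s, 0 <= s <= t -> `|z s - w s| <= f s) ->
  `|vint z t - vint w t| <= \int[mu]_(s in `[0, t]) f s.
Proof.
move=> zr wr fr /andP[t0 tT] zwf.
apply: rV_norm_le.
  apply: Rintegral_ge0 => s /=; rewrite in_itv/= => st.
  by apply: le_trans (zwf _ st).
move=> i; rewrite !mxE -RintegralB//.
- apply: (Rintegral_norm_le T0) => //; first by apply: rcbB; exact: rcb_coord.
  move=> s st; apply: le_trans (zwf _ st).
  by have := rV_coord_le (z s - w s) i; rewrite !mxE.
- by apply: (rcb_integrable T0) => //; exact: rcb_coord.
- by apply: (rcb_integrable T0) => //; exact: rcb_coord.
Qed.

Lemma vint_lip z B : rcb T z -> (forall s, 0 <= s <= T -> `|z s| <= B) ->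
  lipT T B (vint z).
Proof.
move=> zr zB s t sT tT.
have B0 : 0 <= B by apply: le_trans (zB _ sT).
apply: rV_norm_le => [|i]; first exact: mulr_ge0.
rewrite !mxE; apply: (Rintegral_lip T0) => //; first exact: rcb_coord.
move=> r rT; apply: le_trans (zB _ rT); exact: rV_coord_le.
Qed.

Lemma vint0 z : vint z 0 = 0.
Proof. by apply/rowP => i; rewrite !mxE set_itv1 Rintegral_set1. Qed.

Lemma eq_vint z w t : t <= T -> (forall s, 0 <= s <= T -> z s = w s) ->
  vint z t = vint w t.
Proof.
move=> tT zw; apply/rowP => i; rewrite !mxE; apply: eq_Rintegral => s.
by rewrite inE/= in_itv/= => /andP[s0 st]; rewrite zw// s0 (le_trans st).
Qed.

End vector_integral.

Lemma near_dist_le {R : realType} {V : normedModType R} (v : V) (e : R) :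
  0 < e -> \forall w \near v, `|v - w| <= e.
Proof. by move=> e0; have /cvgrPdist_le/(_ _ e0) := @cvg_id _ (nbhs v). Qed.

Lemma dyadic_le0 {R : realType} (a b : R) : (forall n, a <= b / 2 ^+ n) -> a <= 0.
Proof.
move=> ab; rewrite leNgt; apply/negP => a0.
pose n := (Num.trunc (b / a)).+1.
have : b / a < 2 ^+ n.
  apply: (lt_trans (truncnS_gt _)); rewrite -natrX ltr_nat; exact: ltn_expl.
by rewrite ltr_pdivrMr// mulrC -ltr_pdivrMr ?exprn_gt0// ltNge ab.
Qed.

Section picard.
Context {R : realType} {m : nat} (T : R).
Hypothesis T0 : 0 < T.
Local Notation mu := (@lebesgue_measure R).
Variables (F : 'rV[R]_m -> 'rV[R]_m) (K B : R).
Hypothesis K0 : 0 < K.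
Hypothesis F_lip : forall v w, `|F v - F w| <= K * `|v - w|.
Hypothesis F_bnd : forall v, `|F v| <= B.
Variable x : R -> 'rV[R]_m.
Hypothesis xr : rcb T x.

Let B0 : 0 <= B. Proof. by apply: le_trans (F_bnd 0). Qed.

Let Fc : continuous F.
Proof.
move=> v; apply/(@cvgrPdist_le _ _ _ (nbhs v)) => e e0.
apply: filterS (near_dist_le v (divr_gt0 e0 K0)) => w vw.
by apply: (le_trans (F_lip _ _)); rewrite -ler_pdivlMl// mulrC.
Qed.

Let Fz z : rcb T z -> rcb T (F \o z).
Proof.
apply: (rcb_comp Fc B0) => v; apply: (le_trans (F_bnd v)).
by rewrite ler_peMr// lerDl.
Qed.

Let G (g : R -> 'rV[R]_m) : R -> 'rV[R]_m := vint (fun s => F (x s + g s)).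

Let G_lip g : rcb T g -> lipT T B (G g).
Proof. by move=> gr; apply: (vint_lip T0) => //; apply: Fz; exact: rcbD. Qed.

(* In the sup norm weighted by exp (- 2 K t), [G] is a contraction of ratio 1/2. *)
Let G_contract f g c : rcb T f -> rcb T g -> 0 <= c ->
  (forall t, 0 <= t <= T -> `|f t - g t| <= c * expR (2 * K * t)) ->
  forall t, 0 <= t <= T -> `|G f t - G g t| <= c / 2 * expR (2 * K * t).
Proof.
move=> fr gr c0 fg t tT; have [t0 tT'] := andP tT.
apply: (@le_trans _ _ (\int[mu]_(s in `[0, t]) (c * K * expR (2 * K * s)))).
  apply: (vint_le T0) => //.
  - by apply: Fz; exact: rcbD.
  - by apply: Fz; exact: rcbD.
  - by apply: rcbZ; exact: rcb_expM.
  move=> s /andP[s0 st]; apply: (le_trans (F_lip _ _)).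
  rewrite opprD addrACA subrr add0r (mulrC c) -[leRHS]mulrA ler_wpM2l ?(ltW K0)//.
  by apply: fg; rewrite s0 (le_trans st).
rewrite RintegralZl//; last by apply: (rcb_integrable T0) => //; exact: rcb_expM.
by rewrite -[leLHS]mulrA -[leRHS]mulrA (mulrC 2^-1) ler_wpM2l// Rintegral_expM.
Qed.

(** Picard's theorem for a bounded, globally Lipschitz vector field [F]; the
    solution is x + g. *)
Lemma picard : exists g, lipT T B g /\
  forall t, 0 <= t <= T -> g t = vint (fun s => F (x s + g s)) t.
Proof.
pose g_ n := iter n G (fun=> 0).
have g_lip n : lipT T B (g_ n).
  elim: n => [|n IH]; last exact/G_lip/(lipT_rcb T0 IH).
  by move=> s t _ _; rewrite subrr normr0 mulr_ge0.
have g_r n : rcb T (g_ n) := lipT_rcb T0 (g_lip n).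
pose c := B * T.
have c0 : 0 <= c by rewrite mulr_ge0// ltW.
have step n t : 0 <= t <= T ->
    `|g_ n.+1 t - g_ n t| <= c / 2 ^+ n * expR (2 * K * t).
  elim: n t => [|n IH] t tT.
    rewrite expr0 divr1 subr0.
    have T00 : 0 <= (0 : R) <= T by rewrite lexx ltW.
    have := g_lip 1%N _ _ tT T00; rewrite /= [X in _ - X]vint0 !subr0.
    have [t0 tT'] := andP tT; rewrite ger0_norm// => /le_trans; apply.
    apply: (@le_trans _ _ c); first by rewrite ler_wpM2l.
    by rewrite ler_peMr// -expR0 ler_expR !mulr_ge0// ltW.
  have := @G_contract (g_ n.+1) (g_ n) (c / 2 ^+ n) (g_r _) (g_r _).
  have -> : c / 2 ^+ n / 2 = c / 2 ^+ n.+1 by rewrite exprSr invfM mulrA.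
  by apply => //; rewrite divr_ge0// exprn_ge0.
have lim t (i : 'I_m) : exists l, 0 <= t <= T ->
    forall n, `|g_ n t 0 i - l| <= 2 * c / 2 ^+ n * expR (2 * K * t).
  have [tT|] := boolP (0 <= t <= T); last by exists 0.
  have [|n|l lP] := @dyadic_cauchy _ (fun n => g_ n t 0 i) (c * expR (2 * K * t)).
  - by rewrite mulr_ge0// expR_ge0.
  - rewrite mulrAC; apply: le_trans (step n _ tT).
    by have := rV_coord_le (g_ n.+1 t - g_ n t) i; rewrite !mxE.
  - by exists l => _ n; apply: (le_trans (lP n)); rewrite mulrA mulrAC.
pose g t : 'rV[R]_m := \row_i projT1 (cid (lim t i)).
have gP n t : 0 <= t <= T ->
    `|g_ n t - g t| <= 2 * c / 2 ^+ n * expR (2 * K * t).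
  move=> tT; apply: rV_norm_le => [|i].
    by rewrite mulr_ge0 ?expR_ge0// divr_ge0 ?exprn_ge0// mulr_ge0.
  by rewrite !mxE; case: cid => l /= /(_ tT).
have small := @dyadic_le0 R.
have g_lip' : lipT T B g.
  move=> s t sT tT; rewrite -subr_le0.
  apply: (@small _ (2 * c * expR (2 * K * s) + 2 * c * expR (2 * K * t))) => n.
  have -> : g s - g t = (g_ n s - g_ n t) - (g_ n s - g s) + (g_ n t - g t).
    by apply/rowP => i; rewrite !mxE; ring.
  have := g_lip n _ _ sT tT; have := gP n _ sT; have := gP n _ tT.
  have := ler_normD (g_ n s - g_ n t - (g_ n s - g s)) (g_ n t - g t).
  have := ler_normB (g_ n s - g_ n t) (g_ n s - g s).
  have -> : (2 * c * expR (2 * K * s) + 2 * c * expR (2 * K * t)) / 2 ^+ n =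
      2 * c / 2 ^+ n * expR (2 * K * s) + 2 * c / 2 ^+ n * expR (2 * K * t).
    by ring.
  lra.
exists g; split => // t tT; apply/eqP; rewrite -subr_eq0 -normr_le0.
have gr : rcb T g := lipT_rcb T0 g_lip'.
apply: (@small _ (2 * c * expR (2 * K * t))) => n.
have e1 := gP n.+1 _ tT.
have n0 : 0 <= 2 * c / 2 ^+ n by rewrite divr_ge0 ?exprn_ge0// mulr_ge0.
have e2 := @G_contract (g_ n) g _ (g_r n) gr n0 (gP n) t tT.
rewrite mulrAC.
have -> : 2 * c / 2 ^+ n * expR (2 * K * t) =
    2 * c / 2 ^+ n.+1 * expR (2 * K * t) + 2 * c / 2 ^+ n / 2 * expR (2 * K * t).
  by rewrite exprSr invfM; field; rewrite expf_neq0.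
rewrite -/(G g) -[g t](subrK (g_ n.+1 t)) -addrA.
apply: (le_trans (ler_normD _ _)); apply: lerD; first by rewrite distrC.
exact: e2.
Unshelve. all: by end_near. Qed.

End picard.

Section ball_lipschitz.
Context {R : realType} {m : nat}.
Variable h : 'rV[R]_m -> 'rV[R]_m.
Hypothesis h_lip : forall v : 'rV[R]_m,
  exists2 U, nbhs v U & [lipschitz h w | w in U].

Lemma locally_lipschitz_near (v : 'rV[R]_m) : exists L : R, 0 < L /\
  \forall w \near v & w' \near v, `|h w - h w'| <= L * `|w - w'|.
Proof.
have [U Uv [M [_ MP]]] := h_lip v.
exists (`|M| + 1); split; first by rewrite ltr_wpDl.
exists (U, U) => // -[w w'] /= [Uw Uw'].
apply: (MP (`|M| + 1) _ (w, w')) => //.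
by apply: (le_lt_trans (ler_norm M)); rewrite ltrDl.
Qed.

Lemma locally_lipschitz_continuous : continuous h.
Proof.
move=> v; have [L [L0 [[U U'] /= [Uv Uv'] UP]]] := locally_lipschitz_near v.
apply/(@cvgrPdist_le _ _ _ (nbhs v)) => e e0.
apply: filterS2 Uv' (near_dist_le v (divr_gt0 e0 L0)) => w Uw vw.
apply: (le_trans (UP (v, w) (conj (nbhs_singleton Uv) Uw))) => /=.
by rewrite -ler_pdivlMl// mulrC.
Qed.

(** On the compact set of pairs of points of the ball, the difference quotient is
    locally bounded: near the diagonal because [h] is locally Lipschitz, and away
    from it because [h] is continuous. *)
Lemma lipschitz_on_ball N : exists2 K, 0 < K &
  forall v w, `|v| <= N -> `|w| <= N -> `|h v - h w| <= K * `|v - w|.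
Proof.
pose A := [set v : 'rV[R]_m | `|v| <= N].
have cA : compact A.
  apply: bounded_closed_compact.
    exists N; split; first exact: num_real.
    by move=> M NM v /= /le_trans; apply; exact: ltW.
  apply: (@closed_comp _ _ (fun v : 'rV[R]_m => `|v|) [set r : R | r <= N]).
    by move=> v _; exact: norm_continuous.
  exact: closed_le.
have /compact_near_coveringP cAA := compact_setX cA cA.
pose P (K : R) (p : 'rV[R]_m * 'rV[R]_m) := `|h p.1 - h p.2| <= K * `|p.1 - p.2|.
have loc p : (A `*` A) p -> \forall p' \near p & K \near +oo, P K p'.
  move=> _; case: (eqVneq p.1 p.2) => [|p12].
    case: p => v _ /= <-.
    have [L [L0 [[U U'] /= [Uv Uv'] UP]]] := locally_lipschitz_near v.
    exists (U `*` U', [set K | L < K]) => /=.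
      split; first by exists (U, U').
      by exists L; split; first exact: num_real.
    move=> [[w w'] K] /= [[Uw Uw'] LK]; apply: (le_trans (UP (w, w') _)) => //=.
    by rewrite ler_wpM2r// ltW.
  pose H := `|h p.1 - h p.2| + 1; pose d := `|p.1 - p.2|.
  have d0 : 0 < d by rewrite normr_gt0 subr_eq0.
  have H0 : 0 <= H by rewrite addr_ge0.
  have c1 : (fun q : 'rV[R]_m * 'rV[R]_m => `|h q.1 - h q.2|) @ p --> `|h p.1 - h p.2|.
    apply: cvg_norm; apply: cvgB.
      apply: continuous_cvg; [exact: locally_lipschitz_continuous|exact: cvg_fst].
    apply: continuous_cvg; [exact: locally_lipschitz_continuous|exact: cvg_snd].
  have c2 : (fun q : 'rV[R]_m * 'rV[R]_m => `|q.1 - q.2|) @ p --> d.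
    by apply: cvg_norm; apply: cvgB; [exact: cvg_fst|exact: cvg_snd].
  exists ([set q | `|h q.1 - h q.2| <= H /\ d / 2 <= `|q.1 - q.2|],
          [set K | H / (d / 2) < K]) => /=.
    split; last by exists (H / (d / 2)); split; first exact: num_real.
    near=> q; split.
      by near: q; apply: (cvgr_le _ c1); rewrite ltrDl.
    by near: q; apply: (cvgr_ge _ c2); lra.
  move=> [q K] /= [[qH qd] HK]; rewrite /P/=; apply: (le_trans qH).
  have d2 : 0 < d / 2 by rewrite divr_gt0.
  have K0 : 0 <= K by apply: ltW; apply: le_lt_trans HK; rewrite divr_ge0// ltW.
  apply: (@le_trans _ _ (K * (d / 2))); last by rewrite ler_wpM2l.
  by rewrite -ler_pdivrMr// ltW.
have [K [_ KP]] := cAA R +oo P _ loc.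
exists (`|K| + 1); first by rewrite ltr_wpDl.
move=> v w vN wN; apply: (KP (`|K| + 1) _ (v, w)) => //.
by apply: (le_lt_trans (ler_norm K)); rewrite ltrDl.
Unshelve. all: by end_near. Qed.

End ball_lipschitz.

Section clip.
Context {R : realType} {m : nat} (N : R).
Hypothesis N0 : 0 <= N.

(** The coordinatewise projection on the cube of half-side [N]. *)
Definition clip (v : 'rV[R]_m) : 'rV[R]_m :=
  \row_i Num.max (- N) (Num.min N (v 0 i)).

Lemma clip_le v : `|clip v| <= N.
Proof.
apply: rV_norm_le => // i; rewrite mxE ler_norml le_max lexx/=.
by rewrite ge_max ge_min lexx/= andbT -subr_ge0 opprK addr_ge0.
Qed.

Lemma clip_id v : `|v| <= N -> clip v = v.
Proof.
move=> vN; apply/rowP => i; rewrite mxE.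
have : `|v 0 i| <= N by apply: le_trans vN; exact: rV_coord_le.
by rewrite ler_norml => /andP[? ?]; rewrite min_r// max_r.
Qed.

Let clip_coord (a : R) : let c := Num.max (- N) (Num.min N a) in
  [\/ a <= - N /\ c = - N, - N <= a <= N /\ c = a | N <= a /\ c = N].
Proof.
move=> c; rewrite /c; case: (leP N a) => [Na|aN].
  by constructor 3; rewrite max_r// -subr_ge0 opprK addr_ge0.
case: (leP (- N) a) => [Na|/ltW aN'].
  by constructor 2; rewrite ltW.
by constructor 1.
Qed.

Lemma clip_lip v w : `|clip v - clip w| <= `|v - w|.
Proof.
apply: rV_norm_le => // i; rewrite !mxE.
have := rV_coord_le (v - w) i; rewrite !mxE; apply: le_trans.
have := ler_norm (v 0 i - w 0 i); have := ler_norm (- (v 0 i - w 0 i)).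
rewrite normrN ler_norml; have N0' := N0.
by case: (clip_coord (v 0 i)) => -[? ->]; case: (clip_coord (w 0 i)) => -[? ->];
  move=> ? ?; apply/andP; split; lra.
Qed.

Lemma clip_norm v : `|clip v| <= `|v|.
Proof.
have := clip_lip v 0; rewrite subr0; congr (`|_| <= _).
by rewrite [clip 0]clip_id ?normr0// subr0.
Qed.

End clip.

Section ode.
Context {R : realType} {m : nat} (T : R).
Hypothesis T0 : 0 < T.
Local Notation mu := (@lebesgue_measure R).
Implicit Types (x y : R -> 'rV[R]_m) (F : 'rV[R]_m -> 'rV[R]_m).

(** [y] solves the integral equation with forcing [x] and vector field [F]. *)
Definition solves F x y : Prop :=
  forall t, 0 <= t <= T -> y t = x t + vint (F \o y) t.

(** The linear growth of [F] in integrated form. *)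
Lemma vint_growth F C y t : continuous F -> 0 < C ->
  (forall v, `|F v| <= C * (1 + `|v|)) -> rcb T y -> 0 <= t <= T ->
  `|vint (F \o y) t| <= C * t + C * \int[mu]_(s in `[0, t]) `|y s|.
Proof.
move=> Fc C0 FC yr tT; have [t0 tT'] := andP tT.
have yn := rcb_norm yr.
have r0 : rcb T (fun=> 0 : 'rV[R]_m).
  by split; [move=> s _; exact: cvg_cst|exists 0 => s _; rewrite normr0].
have -> : vint (F \o y) t = vint (F \o y) t - vint (fun=> 0) t.
  rewrite [X in _ - X](_ : _ = 0) ?subr0//; apply/rowP => i; rewrite !mxE.
  by rewrite Rintegral_cst_itv// mul0r.
apply: (@le_trans _ _ (\int[mu]_(s in `[0, t]) (C * (1 + `|y s|)))).
  apply: (vint_le T0) => //; first exact: (rcb_comp Fc (ltW C0) FC yr).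
    by apply: rcbZ; apply: rcbD => //; exact: rcb_cst.
  by move=> s _; rewrite subr0; exact: FC.
rewrite RintegralZl//; last first.
  by apply: (rcb_integrable T0) => //; apply: rcbD => //; exact: rcb_cst.
rewrite RintegralD//; last 2 first.
  by apply: (rcb_integrable T0) => //; exact: rcb_cst.
  exact: (rcb_integrable T0).
by rewrite Rintegral_cst_itv// subr0 mul1r mulrDr.
Qed.

(** The bound depends on the forcing [x] only through its bound [X]. *)
Lemma solution_bound F C X x y : continuous F -> 0 < C ->
  (forall v, `|F v| <= C * (1 + `|v|)) -> 0 <= X ->
  (forall t, 0 <= t <= T -> `|x t| <= X) -> rcb T y -> solves F x y ->
  forall t, 0 <= t <= T -> `|y t| <= 2 * (X + C * T) * expR (2 * C * T).
Proof.
move=> Fc C0 FC X0 xX yr yF t tT.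
have CT0 : 0 <= X + C * T by rewrite addr_ge0// mulr_ge0// ltW.
apply: (@le_trans _ _ (2 * (X + C * T) * expR (2 * C * t))).
  apply: (gronwall T0 (rcb_norm yr)) => // s sT.
  rewrite (yF _ sT); apply: (le_trans (ler_normD _ _)); rewrite -addrA.
  apply: lerD; first exact: xX.
  apply: (le_trans (vint_growth Fc C0 FC yr sT)).
  by rewrite lerD2r ler_wpM2l ?(ltW C0)//; case/andP: sT.
rewrite ler_wpM2l ?mulr_ge0// ler_expR ler_wpM2l//; last by case/andP: tT.
by rewrite mulr_ge0// ltW.
Qed.

(** The constant [K] is only required to be a Lipschitz constant on a ball
    containing the two solutions. *)
Lemma solution_stability F K N x x' y y' C : continuous F -> 0 < C ->
  (forall v, `|F v| <= C * (1 + `|v|)) -> 0 < K ->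
  (forall v w, `|v| <= N -> `|w| <= N -> `|F v - F w| <= K * `|v - w|) ->
  rcb T x -> rcb T x' -> rcb T y -> rcb T y' ->
  solves F x y -> solves F x' y' ->
  (forall t, 0 <= t <= T -> `|y t| <= N) ->
  (forall t, 0 <= t <= T -> `|y' t| <= N) ->
  forall t, 0 <= t <= T -> `|vint (F \o y) t - vint (F \o y') t| <=
    2 * (K * \int[mu]_(s in `[0, T]) `|x s - x' s|) * expR (2 * K * T).
Proof.
move=> Fc C0 FC K0 FK xr x'r yr y'r yF y'F yN y'N t tT.
pose I := \int[mu]_(s in `[0, T]) `|x s - x' s|.
have Fr : rcb T (F \o y) := rcb_comp Fc (ltW C0) FC yr.
have F'r : rcb T (F \o y') := rcb_comp Fc (ltW C0) FC y'r.
have Gr (z : R -> 'rV[R]_m) : rcb T z -> rcb T (vint z).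
  by move=> zr; have [_ [M zM]] := zr; apply: (lipT_rcb T0); exact: (vint_lip T0 zr zM).
have I0 : 0 <= I by apply: Rintegral_ge0.
have KI0 : 0 <= K * I by rewrite mulr_ge0// ltW.
have dxr := rcb_norm (rcbB xr x'r).
have dGr := rcb_norm (rcbB (Gr _ Fr) (Gr _ F'r)).
rewrite -/I; apply: (@le_trans _ _ (2 * (K * I) * expR (2 * K * t))); last first.
  apply: ler_wpM2l; first exact: mulr_ge0.
  rewrite ler_expR; apply: ler_wpM2l; last by case/andP: tT.
  by rewrite mulr_ge0// ltW.
apply: (gronwall T0 dGr) => // {tT}t tT; have [t0 tT'] := andP tT.
apply: (@le_trans _ _ (\int[mu]_(s in `[0, t])
    (K * (`|x s - x' s| + `|vint (F \o y) s - vint (F \o y') s|)))).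
  apply: (vint_le T0) => //; first by apply: rcbZ; exact: rcbD.
  move=> s /andP[s0 st].
  have sT : 0 <= s <= T by rewrite s0 (le_trans st).
  apply: (le_trans (FK _ _ (yN _ sT) (y'N _ sT))).
  rewrite ler_wpM2l ?(ltW K0)// (yF _ sT) (y'F _ sT) opprD addrACA.
  exact: ler_normD.
rewrite RintegralZl//; last by apply: (rcb_integrable T0) => //; exact: rcbD.
rewrite RintegralD//; [|exact: (rcb_integrable T0)..].
rewrite -mulrDr ler_wpM2l ?(ltW K0)// lerD2r.
rewrite -subr_ge0 (Rintegral_sub T0 dxr) ?t0//.
by apply: Rintegral_ge0.
Qed.

Section locally_lipschitz.
Variable h : 'rV[R]_m -> 'rV[R]_m.
Hypothesis h_lip : forall v : 'rV[R]_m,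
  exists2 U, nbhs v U & [lipschitz h w | w in U].
Variable C : R.
Hypothesis C0 : 0 < C.
Hypothesis hC : forall v, `|h v| <= C * (1 + `|v|).

Lemma solution_exists x : rcb T x -> exists B g, lipT T B g /\
  solves h x (fun t => x t + g t).
Proof.
move=> xr; have [X0 xX0] := xr.2.
pose X := `|X0|.
have xX t : 0 <= t <= T -> `|x t| <= X.
  by move=> tT; apply: (le_trans (xX0 _ tT)); exact: ler_norm.
have X00 : 0 <= X by exact: normr_ge0.
pose N := 2 * (X + C * T) * expR (2 * C * T).
have N0 : 0 <= N by rewrite mulr_ge0 ?expR_ge0// mulr_ge0// addr_ge0// mulr_ge0// ltW.
(* [N] is the a priori bound, which also holds for the truncated equation, so
   that truncating [h] outside the ball of radius [N] leaves the solution
   unchanged. *)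
have [K K0 hK] := lipschitz_on_ball h_lip N.
pose F := h \o clip N.
have F_lip v w : `|F v - F w| <= K * `|v - w|.
  apply: (le_trans (hK _ _ (clip_le N0 v) (clip_le N0 w))).
  by rewrite ler_wpM2l ?(ltW K0)// clip_lip.
have F_bnd v : `|F v| <= C * (1 + N).
  by apply: (le_trans (hC _)); rewrite ler_wpM2l ?(ltW C0)// lerD2l clip_le.
have FC v : `|F v| <= C * (1 + `|v|).
  by apply: (le_trans (hC _)); rewrite ler_wpM2l ?(ltW C0)// lerD2l clip_norm.
have Fc : continuous F.
  move=> v; apply/(@cvgrPdist_le _ _ _ (nbhs v)) => e e0.
  apply: filterS (near_dist_le v (divr_gt0 e0 K0)) => w vw.
  by apply: (le_trans (F_lip _ _)); rewrite -ler_pdivlMl// mulrC.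
have [g [g_lip gF]] := picard T0 K0 F_lip F_bnd xr.
exists (C * (1 + N)), g; split => // t tT.
pose y t := x t + g t.
have yr : rcb T y by apply: rcbD => //; exact: lipT_rcb g_lip.
have yF : solves F x y by move=> s sT; rewrite /y gF.
have yN := solution_bound Fc C0 FC X00 xX yr yF.
rewrite {1}gF//; congr (_ + _); apply: (@eq_vint _ _ T) => [|s sT].
  by case/andP: tT.
by rewrite /F /= clip_id//; exact: yN.
Qed.

Lemma solution_unique x y y' : rcb T x -> rcb T y -> rcb T y' ->
  solves h x y -> solves h x y' -> forall t, 0 <= t <= T -> y t = y' t.
Proof.
move=> xr yr y'r yh y'h t tT.
have [[N yN] [N' y'N]] := (yr.2, y'r.2).
have [K K0 hK] := lipschitz_on_ball h_lip (Num.max N N').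
have yN2 s : 0 <= s <= T -> `|y s| <= Num.max N N'.
  by move=> sT; rewrite le_max yN.
have y'N2 s : 0 <= s <= T -> `|y' s| <= Num.max N N'.
  by move=> sT; rewrite le_max y'N// orbT.
have hc := locally_lipschitz_continuous h_lip.
have := solution_stability hc C0 hC K0 hK xr xr yr y'r yh y'h yN2 y'N2 tT.
under eq_Rintegral do rewrite subrr normr0.
rewrite Rintegral_cst_itv ?(ltW T0)// mul0r mulr0 mulr0 mul0r normr_le0 subr_eq0.
by move=> /eqP e; rewrite (yh _ tT) (y'h _ tT) e.
Qed.

End locally_lipschitz.

End ode.

(** * Existence of parametric representations *)
Section cadlag_window.
Context {R : realType} (T : R).
Variable x : cadlag R^o T.
Implicit Types t s e : R.

Let X : R -> R := x.
Let Xl : R -> R := left_limit x.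

(** Near a point, on either side, the path and its left limits are both close to
    the corresponding one-sided limit. *)
Lemma cadlag_right_window t e : 0 <= t < T -> 0 < e -> exists2 d, 0 < d &
  forall s, t < s < t + d -> s <= T -> `|X s - X t| <= e /\ `|Xl s - X t| <= e.
Proof.
move=> tT e0; have [d d0 dP] := cadlag_right x tT e0.
exists d => // s /andP[ts sd] sT; split; first by apply/ltW/dP; lra.
apply: (@left_limit_le _ _ _ x s (X t) t) => //; first lra.
by move=> r /andP[tr rs]; apply/ltW/dP; lra.
Qed.

Lemma cadlag_left_window t e : 0 < t <= T -> 0 < e -> exists2 d, 0 < d <= t &
  forall s, t - d < s < t -> `|X s - Xl t| <= e /\ `|Xl s - Xl t| <= e.
Proof.
move=> tT e0; have [d /andP[d0 dt] dP] := cadlag_left x tT e0.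
exists d; first by rewrite d0.
move=> s /andP[ts st]; split; first by apply/ltW/dP; lra.
apply: (@left_limit_le _ _ _ x s (Xl t) (t - d)) => //; [lra|lra|].
by move=> r /andP[tr rs]; apply/ltW/dP; lra.
Qed.

(** The jump times are countably many: a jump time is the first time after some
    rational [a] at which the path is beyond some rational level [b]. *)
Lemma jumps_enum : exists tau : nat -> R, forall t, 0 < t <= T ->
  Xl t != X t -> exists n, tau n = t.
Proof.
pose f (p : rat * rat * bool) : R := inf [set v : R | ratr p.1.1 < v /\
  (if p.2 then ratr p.1.2 < X v else X v < ratr p.1.2)].
exists (fun n => if unpickle n is Some p then f p else 0) => t tT jt.
suff [p fp] : exists p, f p = t by exists (pickle p); rewrite pickleK.
have infE (A : set R) a : A t -> (forall v, A v -> t <= v) -> inf A = t.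
  move=> At tA; apply/eqP; rewrite eq_le; apply/andP; split.
    by apply: ge_inf => //; exists t.
  by apply: lb_le_inf => //; exists t.
have [t0 _] := andP tT.
case: (ltgtP (Xl t) (X t)) jt => // XX _.
  have [b bX] := rat_in_itvoo XX.
  rewrite in_itv/= in bX.
  have [|d /andP[d0 dt] dP] := cadlag_left x tT (e := ratr b - Xl t); first lra.
  have [a aX] : exists a, ratr a \in `](t - d), t[ by apply: rat_in_itvoo; lra.
  rewrite in_itv/= in aX.
  exists (a, b, true); apply: (infE) => //=; first by split; lra.
  move=> v [av bv]; rewrite leNgt; apply/negP => vt.
  have /dP : t - d < v < t by lra.
  by move=> /ltr_normlW; rewrite -/(X v) -/(Xl t); lra.
have [b bX] := rat_in_itvoo XX.
rewrite in_itv/= in bX.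
have [|d /andP[d0 dt] dP] := cadlag_left x tT (e := Xl t - ratr b); first lra.
have [a aX] : exists a, ratr a \in `](t - d), t[ by apply: rat_in_itvoo; lra.
rewrite in_itv/= in aX.
exists (a, b, false); apply: (infE) => //=; first by split; lra.
move=> v [av bv]; rewrite leNgt; apply/negP => vt.
have /dP : t - d < v < t by lra.
by rewrite distrC => /ltr_normlW; rewrite -/(X v) -/(Xl t); lra.
Qed.

End cadlag_window.

(** A clock: [L t th] is lexicographically nondecreasing in (t, th), strictly
    increasing in [t], and strictly increasing in [th] when [t] is a term of the
    sequence [tau]. It is the sum of [t] and of a series in which the [n]-th
    term increases linearly from 0 to 2 ^- n as [th] runs through [0, 1] at
    the time [tau n]. *)
Lemma clock_exists {R : realType} (tau : nat -> R) : exists L : R -> R -> R,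
  [/\ forall t th t' th', 0 <= th <= 1 -> 0 <= th' <= 1 -> t < t' ->
        L t th < L t' th',
      forall t th th', 0 <= th -> th <= th' -> th' <= 1 -> L t th <= L t th' &
      forall t th th', 0 <= th -> th < th' -> th' <= 1 ->
        (exists n, tau n = t) -> L t th < L t th'].
Proof.
pose c t th n : R := if tau n < t then 1 else if tau n == t then th else 0.
pose w t th n : R := c t th n / 2 ^+ n.
have p2 n : 0 < 2 ^+ n :> R by rewrite exprn_gt0.
have c01 t th n : 0 <= th <= 1 -> 0 <= c t th n <= 1.
  by rewrite /c; case: ifP => _; [lra|case: ifP => _; lra].
have wc t th : 0 <= th <= 1 -> cvgn (series (w t th)).
  move=> th01; apply: (@series_le_cvg _ _ (geometric 1 2^-1)).
  - by move=> n; rewrite divr_ge0 ?(ltW (p2 n))//; have := c01 t th n th01; lra.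
  - by move=> n; rewrite /geometric/= mul1r exprn_ge0// invr_ge0.
  - move=> n; rewrite /geometric/= mul1r exprVn /w ler_pdivrMr// mulVf ?gt_eqF//.
    by have := c01 t th n th01; lra.
  - by apply: is_cvg_geometric_series; rewrite ger0_norm ?invr_ge0// invf_lt1// ltr1n.
pose S t th := limn (series (w t th)).
have wle t th t' th' : 0 <= th <= 1 -> 0 <= th' <= 1 ->
    (t < t' \/ t = t' /\ th <= th') -> forall n, w t th n <= w t' th' n.
  move=> h1 h2 h n; rewrite /w ler_wpM2r ?invr_ge0 ?(ltW (p2 n))//.
  rewrite /c; case: h => [tt|[<- hh]].
    case: ifP => [nt|_]; first by rewrite (lt_trans nt tt).
    case: eqP => [->|_]; first by rewrite tt; case/andP: h1.
    by have := c01 t' th' n h2; rewrite /c; lra.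
  by case: ifP => // _; case: ifP.
have Sle t th t' th' : 0 <= th <= 1 -> 0 <= th' <= 1 ->
    (t < t' \/ t = t' /\ th <= th') -> S t th <= S t' th'.
  by move=> h1 h2 h; apply: lim_series_le; [exact: wc|exact: wc|exact: wle].
exists (fun t th => t + S t th); split.
- by move=> t th t' th' h1 h2 tt; apply: ltr_leD => //; apply: Sle => //; left.
- move=> t th th' h0 h h1; rewrite lerD2l; apply: Sle; [lra|lra|by right].
- move=> t th th' h0 h h1 [n nt]; rewrite ltrD2l -subr_gt0.
  have [h2 h3] : 0 <= th <= 1 /\ 0 <= th' <= 1 by lra.
  rewrite /S -lim_seriesB; [|exact: wc|exact: wc].
  have wB k : 0 <= (w t th' - w t th) k.
    rewrite [leRHS](_ : _ = w t th' k - w t th k)// subr_ge0.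
    by apply: wle => //; right; split => //; exact: ltW.
  have nd : nondecreasing_seq (series (w t th' - w t th)).
    by apply/nondecreasing_seqP => k; rewrite seriesSr lerDl.
  apply: (@lt_le_trans _ _ (series (w t th' - w t th) n.+1)).
    rewrite seriesSr; apply: ltr_wpDl.
      by rewrite /series/= sumr_ge0.
    rewrite [ltRHS](_ : _ = w t th' n - w t th n)// subr_gt0.
    by rewrite /w /c nt ltxx eqxx ltr_pM2r// invr_gt0.
  apply: nondecreasing_cvgn_le => //.
  by apply: is_cvg_seriesB; exact: wc.
Qed.

Lemma within_continuous_seg {R : realType} (a b : R) (f : R -> R) :
  {within `[a, b], continuous f} <->
  forall s, a <= s <= b -> forall e, 0 < e -> exists2 d, 0 < d &
    forall s', a <= s' <= b -> `|s - s'| < d -> `|f s - f s'| < e.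
Proof.
split.
  move=> /subspace_continuousP fc s sab e e0.
  have {}sab : `[a, b]%classic s by rewrite /= in_itv.
  have /cvgrPdist_lt /(_ _ e0) [d /= d0 dP] := fc _ sab.
  by exists d => // s' s'ab ss'; apply: dP => //=; rewrite in_itv.
move=> H; apply/subspace_continuousP => s; rewrite /= in_itv/= => sab.
apply/cvgrPdist_lt => e e0.
have [d d0 dP] := H s sab e e0.
by exists d => //= s' ss'; rewrite in_itv/= => s'ab; exact: dP.
Qed.

Section clock_inverse.
Context {R : realType} (T : R).
Hypothesis T0 : 0 < T.
Variable L : R -> R -> R.
Hypothesis L_time : forall t th t' th', 0 <= th <= 1 -> 0 <= th' <= 1 ->
  t < t' -> L t th < L t' th'.
Hypothesis L_mono : forall t th th', 0 <= th -> th <= th' -> th' <= 1 ->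
  L t th <= L t th'.

(** The generalized inverse of the clock [L]: the lexicographic supremum of the
    pairs (t, th) of [0, T] * [0, 1] such that [L t th] is at most [s]. If no such
    pair has the first coordinate [clock_inv_time s], the second set is empty, and
    its supremum is 0 by convention, as it should be. *)
Definition clock_inv_time (s : R) : R := sup [set t | 0 <= t <= T /\ L t 0 <= s].
Definition clock_inv_frac (s : R) : R :=
  sup [set th | 0 <= th <= 1 /\ L (clock_inv_time s) th <= s].

Let rho := clock_inv_time.
Let phi := clock_inv_frac.
Let Srho s := [set t | 0 <= t <= T /\ L t 0 <= s].
Let Sphi s := [set th | 0 <= th <= 1 /\ L (rho s) th <= s].

Let rhoub s : has_ubound (Srho s).
Proof. by exists T => t [/andP[]]. Qed.
Let phiub s : has_ubound (Sphi s).
Proof. by exists 1 => t [/andP[]]. Qed.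

Lemma clock_inv_time_in s : L 0 0 <= s -> 0 <= rho s <= T.
Proof.
move=> s0; have S0 : Srho s 0 by split => //; rewrite lexx ltW.
apply/andP; split; first exact: (ub_le_sup (rhoub s)).
by apply: ge_sup => [|t [/andP[]]//]; exists 0.
Qed.

Lemma clock_inv_frac_in s : 0 <= phi s <= 1.
Proof.
rewrite /phi /clock_inv_frac -/rho -/(Sphi s).
have [->|/set0P[th [th1 thL]]] := eqVneq (Sphi s) set0.
  by rewrite sup0 lexx ler01.
apply/andP; split; last by apply: ge_sup => [|t [/andP[]]//]; exists th.
apply: (@le_trans _ _ th); first by case/andP: th1.
exact: (ub_le_sup (phiub s)).
Qed.

Lemma clock_inv_lt s t th : 0 <= t <= T -> 0 <= th <= 1 ->
  rho s < t \/ rho s = t /\ phi s < th -> s < L t th.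
Proof.
move=> tT th1 [rt|[rt pt]]; rewrite ltNge; apply/negP => Ls.
  suff : t <= rho s by lra.
  apply: (ub_le_sup (rhoub s)); split => //; apply: le_trans Ls.
  by apply: L_mono; lra.
suff : th <= phi s by lra.
by apply: (ub_le_sup (phiub s)); split => //; rewrite rt.
Qed.

Lemma clock_inv_time_gt s t th : L 0 0 <= s -> 0 <= t -> 0 <= th <= 1 ->
  t < rho s -> L t th < s.
Proof.
move=> s0 t0 th1 tr.
have ne : Srho s !=set0 by exists 0; split => //; rewrite lexx ltW.
have [t1 [t1T Lt1] tt1] := sup_gt ne tr.
by apply: lt_le_trans Lt1; apply: L_time => //; rewrite lexx ler01.
Qed.

Lemma clock_inv_frac_gt s th : 0 <= th -> th < phi s -> L (rho s) th <= s.
Proof.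
move=> th0 thp.
have ne : Sphi s !=set0.
  by apply/set0P/eqP => e; move: thp; rewrite /phi /clock_inv_frac -/rho -/(Sphi s) e sup0; lra.
have [th1 [th1P Lth1] lt1] := sup_gt ne thp.
by apply: le_trans Lth1; apply: L_mono => //; lra.
Qed.

(* The lexicographic order on the pairs (t, th). *)
Let lex_le (t th t' th' : R) := t < t' \/ t = t' /\ th <= th'.

(** With [clock_inv_le] below: the generalized inverse at [s] separates the pairs
    at which the clock is at most [s] from those at which it exceeds [s]. *)
Lemma clock_inv_ge s t th : 0 <= t <= T -> 0 <= th <= 1 ->
  L t th <= s -> lex_le t th (rho s) (phi s).
Proof.
move=> tT th1 Ls.
case: (ltgtP t (rho s)) => [?|rt|rt]; first by left.
  by have := clock_inv_lt tT th1 (or_introl rt); lra.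
right; split => //; rewrite leNgt; apply/negP => pt.
by have := clock_inv_lt tT th1 (or_intror (conj (esym rt) pt)); lra.
Qed.

Lemma clock_inv_le s t th : L 0 0 <= s -> 0 <= t <= T -> 0 <= th <= 1 ->
  s < L t th -> lex_le (rho s) (phi s) t th.
Proof.
move=> s0 tT th1 sL.
case: (ltgtP (rho s) t) => [?|rt|rt]; first by left.
  by have [t0 _] := andP tT; have := clock_inv_time_gt s0 t0 th1 rt; lra.
right; split => //; rewrite leNgt; apply/negP => pt.
by have [th0 _] := andP th1; have := clock_inv_frac_gt th0 pt; rewrite rt; lra.
Qed.

Lemma clock_inv_homo s s' : L 0 0 <= s -> s <= s' ->
  lex_le (rho s) (phi s) (rho s') (phi s').
Proof.
move=> s0 ss'; have s'0 : L 0 0 <= s' by lra.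
have [rT r'T] := (clock_inv_time_in s0, clock_inv_time_in s'0).
have [p1 p'1] := (clock_inv_frac_in s, clock_inv_frac_in s').
case: (ltgtP (rho s) (rho s')) => [?|rr|rr]; first by left.
  pose t := (rho s + rho s') / 2.
  have h1 : 0 <= t <= T by rewrite /t; lra.
  have h2 : 0 <= (0 : R) <= 1 by lra.
  have h3 : rho s' < t by rewrite /t; lra.
  have h4 : t < rho s by rewrite /t; lra.
  have := clock_inv_lt h1 h2 (or_introl h3).
  by have [h5 _] := andP h1; have := clock_inv_time_gt s0 h5 h2 h4; lra.
right; split => //; rewrite leNgt; apply/negP => pp.
pose th := (phi s + phi s') / 2.
have h1 : 0 <= th <= 1 by rewrite /th; lra.
have h2 : phi s' < th by rewrite /th; lra.
have h3 : th < phi s by rewrite /th; lra.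
have := clock_inv_lt r'T h1 (or_intror (conj erefl h2)).
by have [h5 _] := andP h1; have := clock_inv_frac_gt h5 h3; rewrite rr; lra.
Qed.

Lemma clock_inv_timeK t th : 0 <= t <= T -> 0 <= th <= 1 -> L 0 0 <= L t th ->
  rho (L t th) = t.
Proof.
move=> tT th1 s0.
have rT := clock_inv_time_in s0.
case: (ltgtP (rho (L t th)) t) => // rt.
  by have := clock_inv_lt tT th1 (or_introl rt); rewrite ltxx.
pose t1 := (t + rho (L t th)) / 2.
have h1 : 0 <= t1 by rewrite /t1; lra.
have h2 : t1 < rho (L t th) by rewrite /t1; lra.
have h3 : t < t1 by rewrite /t1; lra.
by have := clock_inv_time_gt s0 h1 th1 h2; have := L_time th1 th1 h3; lra.
Qed.

Lemma clock_inv_fracK t th : 0 <= t <= T -> 0 <= th <= 1 -> L 0 0 <= L t th ->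
  (forall th th', 0 <= th -> th < th' -> th' <= 1 -> L t th < L t th') ->
  phi (L t th) = th.
Proof.
move=> tT th1 s0 Lt; have rE := clock_inv_timeK tT th1 s0.
have p1 := clock_inv_frac_in (L t th).
case: (ltgtP (phi (L t th)) th) => // pt.
  by have := clock_inv_lt tT th1 (or_intror (conj rE pt)); rewrite ltxx.
pose th2 := (th + phi (L t th)) / 2.
have h1 : 0 <= th2 by rewrite /th2; lra.
have h2 : th2 < phi (L t th) by rewrite /th2; lra.
have := clock_inv_frac_gt h1 h2; rewrite rE.
have : L t th < L t th2 by apply: Lt; rewrite /th2; lra.
lra.
Qed.

End clock_inverse.

Lemma lex_squeeze {R : realType} (t t' p p' p'' : R) :
  t < t' \/ t = t' /\ p <= p' -> t' < t \/ t' = t /\ p' <= p'' ->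
  t' = t /\ p <= p' /\ p' <= p''.
Proof.
by case=> [?|[? ?]] [?|[? ?]]; do ?split; lra.
Qed.

(** Balls are convex. *)
Lemma convex_dist {R : realType} (a b p e c : R) :
  0 <= c <= 1 -> `|a - p| <= e -> `|b - p| <= e ->
  `|c * a + (1 - c) * b - p| <= e.
Proof.
move=> c01; rewrite !ler_norml => /andP[h1 h2] /andP[h3 h4].
have -> : c * a + (1 - c) * b - p = c * (a - p) + (1 - c) * (b - p) by ring.
have [c0 c1] := andP c01; have om : 0 <= 1 - c by lra.
have := ler_wpM2l om h3; have := ler_wpM2l om h4.
have := ler_wpM2l c0 h1; have := ler_wpM2l c0 h2.
by move=> ? ? ? ?; apply/andP; split; lra.
Qed.
Section parametric_rep_exists.
Context {R : realType} (T : R).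
Hypothesis T0 : 0 < T.
Variable x : cadlagM1 T.

Let X : R -> R := x.
Let Xl : R -> R := left_limit x.
(* The points of the completed graph at time [t], from x(t-) to x(t). *)
Let pt (t th : R) : R := (1 - th) * Xl t + th * X t.

Let pt_dist t th th' : `|pt t th - pt t th'| = `|th - th'| * `|X t - Xl t|.
Proof. by rewrite -normrM; congr `|_|; rewrite /pt; ring. Qed.

Let pt_near c e t th : 0 <= th <= 1 -> `|X t - c| <= e -> `|Xl t - c| <= e ->
  `|pt t th - c| <= e.
Proof.
move=> th1 XT XlT.
have -> : pt t th = (1 - th) * Xl t + (1 - (1 - th)) * X t by rewrite /pt; ring.
by apply: convex_dist => //; lra.
Qed.

Variable L : R -> R -> R.
Hypothesis L_time : forall t th t' th', 0 <= th <= 1 -> 0 <= th' <= 1 ->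
  t < t' -> L t th < L t' th'.
Hypothesis L_mono : forall t th th', 0 <= th -> th <= th' -> th' <= 1 ->
  L t th <= L t th'.
Hypothesis L_jump : forall t th th', 0 < t <= T -> Xl t != X t ->
  0 <= th -> th < th' -> th' <= 1 -> L t th < L t th'.

Let rho := clock_inv_time T L.
Let phi := clock_inv_frac T L.
Let a := L 0 0.
Let b := L T 1.
Let u s := pt (rho s) (phi s).

Let right_near s e : a <= s -> 0 < e -> exists2 d, 0 < d &
  forall s', s <= s' < s + d -> `|u s - u s'| <= e /\ `|rho s - rho s'| <= e.
Proof.
move=> as_ e0.
have rT := clock_inv_time_in T0 as_; have p1 := clock_inv_frac_in T L s.
rewrite -/rho -/phi in rT p1.
have homo s' : s <= s' -> _ := @clock_inv_homo _ _ T0 _ L_time L_mono s s' as_.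
rewrite -/rho -/phi in homo.
(* Below the upper end of the vertical segment, which may be a single point. *)
have [pl|p_ge1] := ltP (phi s) 1.
  pose D := `|X (rho s) - Xl (rho s)|.
  have D0 : 0 <= D by exact: normr_ge0.
  pose th := Num.min 1 (phi s + e / (D + 1)).
  have eD : 0 < e / (D + 1) by rewrite divr_gt0// ltr_wpDl.
  have th_gt : phi s < th by rewrite lt_min pl ltrDl eD.
  have th_le : th <= phi s + e / (D + 1) by rewrite ge_min lexx orbT.
  have th1 : 0 <= th <= 1 by rewrite ge_min lexx/=; lra.
  have sL : s < L (rho s) th.
    by apply: (clock_inv_lt (T := T) L_mono) => //; right.
  exists (L (rho s) th - s); first by rewrite subr_gt0.
  move=> s' /andP[ss' s'd].
  have as' : a <= s' by lra.
  have sL' : s' < L (rho s) th by lra.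
  have := clock_inv_le T0 L_time L_mono as' rT th1 sL'; rewrite -/rho -/phi => hi.
  have lo := homo s' ss'.
  have [rr [h1 h2]] : rho s' = rho s /\ phi s <= phi s' /\ phi s' <= th.
    exact: lex_squeeze lo hi.
  rewrite /u rr subrr normr0; split; last exact: ltW.
  rewrite pt_dist -/D.
  have : `|phi s - phi s'| <= e / (D + 1) by rewrite ler_norml; lra.
  move/ler_wpM2r => /(_ _ D0) /le_trans; apply.
  by rewrite mulrAC ler_pdivrMr ?ltr_wpDl// ler_pM2l// lerDl.
have pE : phi s = 1 by lra.
have uE : u s = X (rho s) by rewrite /u pE /pt; ring.
(* At the upper end of the segment: the next points have later times. *)
have [rlT|rgeT] := ltP (rho s) T.
  have [|d d0 dP] := @cadlag_right_window _ _ x (rho s) e _ e0; first lra.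
  pose t := Num.min T (rho s + Num.min (d / 2) e).
  have m0 : 0 < Num.min (d / 2) e by rewrite lt_min e0 divr_gt0.
  have t_gt : rho s < t by rewrite lt_min rlT ltrDl m0.
  have mle : Num.min (d / 2) e <= d / 2 /\ Num.min (d / 2) e <= e.
    by rewrite !ge_min !lexx orbT.
  have t_le : t <= rho s + Num.min (d / 2) e by rewrite ge_min lexx orbT.
  have tT : 0 <= t <= T by rewrite ge_min lexx/=; lra.
  have one : 0 <= (1 : R) <= 1 by lra.
  have sL : s < L t 1 by apply: (clock_inv_lt (T := T) L_mono) => //; left.
  exists (L t 1 - s); first by rewrite subr_gt0.
  move=> s' /andP[ss' s'd].
  have as' : a <= s' by lra.
  have sL' : s' < L t 1 by lra.
  have := clock_inv_le T0 L_time L_mono as' tT one sL'; rewrite -/rho -/phi => hi.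
  have lo := homo s' ss'.
  have p'1 := clock_inv_frac_in T L s'; rewrite -/phi in p'1.
  case: lo => [rr|[rr pp]].
    have rt : rho s' <= t by case: hi => [|[]]; lra.
    split; last by rewrite ler_norml; lra.
    have [||h1 h2] := dP (rho s'); [lra|lra|].
    by rewrite uE distrC; exact: pt_near.
  split; last by rewrite rr subrr normr0 ltW.
  have -> : u s' = u s by rewrite uE /u -rr (_ : phi s' = 1) /pt; [ring|lra].
  by rewrite subrr normr0 ltW.
exists 1 => // s' /andP[ss' _].
have as' : a <= s' by lra.
have r'T := clock_inv_time_in T0 as'; have p'1 := clock_inv_frac_in T L s'.
rewrite -/rho -/phi in r'T p'1.
have [rr pp] : rho s' = rho s /\ phi s' = phi s.
  by case: (homo _ ss') => [?|[? ?]]; split; lra.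
by rewrite /u rr pp !subrr normr0 ltW.
Qed.

Let left_near s e : a <= s -> 0 < e -> exists2 d, 0 < d &
  forall s', a <= s' -> s - d < s' <= s ->
    `|u s - u s'| <= e /\ `|rho s - rho s'| <= e.
Proof.
move=> as_ e0.
have rT := clock_inv_time_in T0 as_; have p1 := clock_inv_frac_in T L s.
rewrite -/rho -/phi in rT p1.
have homo s' : a <= s' -> s' <= s -> _ :=
  fun h => @clock_inv_homo _ _ T0 _ L_time L_mono s' s h.
rewrite -/rho -/phi in homo.
have Xl0 : Xl 0 = X 0 := left_limit0 x.
have [r0|r_le0] := ltP 0 (rho s); last first.
  have rE : rho s = 0 by lra.
  exists 1 => // s' as' /andP[_ s's].
  have r'T := clock_inv_time_in T0 as'; rewrite -/rho in r'T.
  have rr : rho s' = 0 by case: (homo _ as' s's) => [?|[? ?]]; lra.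
  have u0 p : pt 0 p = X 0 by rewrite /pt Xl0; ring.
  by rewrite /u rr rE !u0 !subrr normr0 ltW.
have r0T : 0 < rho s <= T by lra.
(* Inside the vertical segment of a jump, or at its upper end. *)
have [/andP[jmp p0]|] := boolP ((Xl (rho s) != X (rho s)) && (0 < phi s)).
  pose D := `|X (rho s) - Xl (rho s)|.
  have D0 : 0 <= D by exact: normr_ge0.
  pose th := Num.max 0 (phi s - e / (D + 1)).
  have eD : 0 < e / (D + 1) by rewrite divr_gt0// ltr_wpDl.
  have th_lt : th < phi s by rewrite gt_max p0 gtrBl eD.
  have th_ge : phi s - e / (D + 1) <= th by rewrite le_max lexx orbT.
  have th0 : 0 <= th by rewrite le_max lexx.
  have th1 : 0 <= th <= 1 by lra.
  have sL : L (rho s) th < s.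
    pose th2 := (th + phi s) / 2.
    have h1 : 0 <= th2 by rewrite /th2; lra.
    have h2 : th2 < phi s by rewrite /th2; lra.
    apply: (@lt_le_trans _ _ (L (rho s) th2)); last exact: (clock_inv_frac_gt (T := T) L_mono).
    by apply: L_jump => //; rewrite /th2; lra.
  exists (s - L (rho s) th); first by rewrite subr_gt0.
  move=> s' as' /andP[s'd s's].
  have sL' : L (rho s) th <= s' by lra.
  have := clock_inv_ge (T := T) L_mono rT th1 sL'; rewrite -/rho -/phi => lo.
  have hi := homo s' as' s's.
  have [rr [h1 h2]] : rho s' = rho s /\ th <= phi s' /\ phi s' <= phi s.
    exact: lex_squeeze lo hi.
  rewrite /u rr subrr normr0; split; last exact: ltW.
  rewrite pt_dist -/D.
  have : `|phi s - phi s'| <= e / (D + 1) by rewrite ler_norml; lra.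
  move/ler_wpM2r => /(_ _ D0) /le_trans; apply.
  by rewrite mulrAC ler_pdivrMr ?ltr_wpDl// ler_pM2l// lerDl.
rewrite negb_and negbK => no_jmp.
have uE p : p <= phi s -> 0 <= p -> pt (rho s) p = Xl (rho s).
  move=> pp p0; case/orP: no_jmp => [/eqP XX|].
    by rewrite /pt -XX; ring.
  by rewrite -leNgt => p_le0; rewrite (_ : p = 0) /pt; [ring|lra].
(* The point is x(t-): the distinct points before it have earlier times. *)
have [d /andP[d0 dr] dP] := @cadlag_left_window _ _ x (rho s) e r0T e0.
pose t := rho s - Num.min (d / 2) e.
have m0 : 0 < Num.min (d / 2) e by rewrite lt_min e0 divr_gt0.
have mle : Num.min (d / 2) e <= d / 2 /\ Num.min (d / 2) e <= e.
  by rewrite !ge_min !lexx orbT.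
have t_lt : t < rho s by rewrite /t; lra.
have tT : 0 <= t <= T by rewrite /t; lra.
have zero : 0 <= (0 : R) <= 1 by lra.
have sL : L t 0 < s by apply: (clock_inv_time_gt T0 L_time) => //; lra.
exists (s - L t 0); first by rewrite subr_gt0.
move=> s' as' /andP[s'd s's].
have sL' : L t 0 <= s' by lra.
have := clock_inv_ge (T := T) L_mono tT zero sL'; rewrite -/rho -/phi => lo.
have hi := homo s' as' s's.
have p'1 := clock_inv_frac_in T L s'; rewrite -/phi in p'1.
have usE : u s = Xl (rho s) by apply: uE; lra.
case: hi => [rr|[rr pp]].
  have rt : t <= rho s' by case: lo => [|[]]; lra.
  rewrite /t in rt.
  split; last by rewrite ler_norml; lra.
  have [|h1 h2] := dP (rho s'); first lra.
  by rewrite usE distrC; exact: pt_near.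
split; last by rewrite rr subrr normr0 ltW.
by rewrite usE /u rr uE ?subrr ?normr0 ?(ltW e0)//; lra.
Qed.

(* The parameter is rescaled affinely from [a, b] to [0, 1]. *)
Let ab : a < b. Proof. by apply: L_time => //; lra. Qed.
Let sigma (s : R) : R := a + s * (b - a).

Let sigma_ge s : 0 <= s <= 1 -> a <= sigma s.
Proof.
by move=> /andP[s0 _]; rewrite /sigma lerDl mulr_ge0// subr_ge0 ltW.
Qed.

Let near_sigma s e : 0 <= s <= 1 -> 0 < e -> exists2 d, 0 < d &
  forall s', 0 <= s' <= 1 -> `|s - s'| < d ->
  `|u (sigma s) - u (sigma s')| < e /\ `|rho (sigma s) - rho (sigma s')| < e.
Proof.
move=> s01 e0.
have e2 : 0 < e / 2 by rewrite divr_gt0.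
have [d1 d10 d1P] := right_near (sigma_ge s01) e2.
have [d2 d20 d2P] := left_near (sigma_ge s01) e2.
have ba : 0 < b - a by rewrite subr_gt0.
exists (Num.min d1 d2 / (b - a)); first by rewrite divr_gt0// lt_min d10.
move=> s' s'01; rewrite ltr_pdivlMr// lt_min => /andP[h1 h2].
have sE : `|sigma s - sigma s'| = `|s - s'| * (b - a).
  by rewrite -[X in _ * X]gtr0_norm// -normrM; congr `|_|; rewrite /sigma; ring.
have s'a := sigma_ge s'01.
have ee : e / 2 < e by lra.
have [ss|ss] := leP (sigma s) (sigma s').
  have [|h3 h4] := d1P (sigma s').
    by move: h1; rewrite -sE ltr_norml; lra.
  by split; apply: le_lt_trans ee.
have [|h3 h4] := d2P (sigma s') s'a.
  by move: h2; rewrite -sE ltr_norml; lra.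
by split; apply: le_lt_trans ee.
Qed.

Lemma clock_parametric_rep :
  parametric_rep x (u \o sigma) (rho \o sigma).
Proof.
split.
- apply/within_continuous_seg => s s01 e e0.
  have [d d0 dP] := near_sigma s01 e0.
  by exists d => // s' s'01 ss'; have [] := dP s' s'01 ss'.
- apply/within_continuous_seg => s s01 e e0.
  have [d d0 dP] := near_sigma s01 e0.
  by exists d => // s' s'01 ss'; have [] := dP s' s'01 ss'.
- apply/seteqP; split => [_ [s /= + <-]|[z t] [/= + [c + zE]]].
    rewrite in_itv/= => s01; split => /=.
      by rewrite in_itv/=; apply: (clock_inv_time_in T0); exact: sigma_ge.
    have p1 := clock_inv_frac_in T L (sigma s); rewrite -/phi in p1.
    exists (1 - phi (sigma s)); first by rewrite in_itv/=; lra.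
    by rewrite /u /pt opprB addrCA subrr addr0.
  rewrite !in_itv/= => tT c1.
  have c1' : 0 <= 1 - c <= 1 by lra.
  have aL : a <= L t (1 - c).
    have [t0|t0] := ltP 0 t; first by apply/ltW/L_time => //; lra.
    have -> : t = 0 by lra.
    by apply: L_mono; lra.
  have Lb : L t (1 - c) <= b.
    have [t0|t0] := ltP t T; first by apply/ltW/L_time => //; lra.
    have -> : t = T by lra.
    by apply: L_mono; lra.
  have ba : 0 < b - a by rewrite subr_gt0.
  exists ((L t (1 - c) - a) / (b - a)).
    rewrite /= in_itv/= divr_ge0 ?subr_ge0// ?(ltW ab)//=.
    by rewrite ler_pdivrMr// mul1r lerD2r.
  have sE : sigma ((L t (1 - c) - a) / (b - a)) = L t (1 - c).
    by rewrite /sigma divfK ?gt_eqF//; ring.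
  have rE := clock_inv_timeK T0 L_time L_mono tT c1' aL; rewrite -/rho in rE.
  congr (_, _); rewrite /= sE // zE /u rE.
  have [t0|t0] := ltP 0 t; last first.
    have -> : t = 0 by lra.
    by rewrite /pt (left_limit0 x : Xl 0 = X 0) -/(X 0) -/(Xl 0) (left_limit0 x : Xl 0 = X 0); ring.
  have [XX|jmp] := eqVneq (Xl t) (X t).
    by rewrite -/(X t) -/(Xl t) /pt XX; ring.
  rewrite /phi (clock_inv_fracK T0 L_time L_mono tT c1' aL).
    by rewrite /pt -/(X t) -/(Xl t); ring.
  by move=> th th' *; apply: L_jump => //; lra.
- move=> s1 s2; rewrite !in_itv/= => s101 s201 s12.
  have s12' : sigma s1 <= sigma s2.
    by rewrite /sigma lerD2l ler_wpM2r// subr_ge0 ltW.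
  have := clock_inv_homo T0 L_time L_mono (sigma_ge s101) s12'.
  rewrite -/rho -/phi => -[?|[rr pp]]; [by left|right; split => //=].
  have dE s : left_limit x (rho s) - u s = phi s * (Xl (rho s) - X (rho s)).
    by rewrite /u /pt -/(Xl (rho s)); ring.
  rewrite [in leRHS]rr !dE rr !normrM ler_wpM2r//.
  have [h1 _] := andP (clock_inv_frac_in T L (sigma s1)).
  have [h2 _] := andP (clock_inv_frac_in T L (sigma s2)).
  by rewrite !ger0_norm.
Qed.

End parametric_rep_exists.

Theorem parametric_rep_exists {R : realType} (T : R) (x : cadlagM1 T) :
  0 < T -> exists u r, parametric_rep x u r.
Proof.
move=> T0; have [tau tauP] := jumps_enum x.
have [L [L_time L_mono L_jump]] := clock_exists tau.
eexists; eexists; apply: (@clock_parametric_rep R T T0 x L L_time L_mono).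
by move=> t th th' tT jmp h1 h2 h3; apply: L_jump => //; exact: tauP.
Qed.

(** * The M1 distance *)
Section broken_line.
Context {R : realType}.
Variables (n : nat) (s : nat -> R).
Hypothesis n0 : (0 < n)%N.
Hypothesis s_homo : forall j, (j < n)%N -> s j <= s j.+1.

(** The broken line through the points (j / n, s j), for j <= n. *)
Definition broken_line (t : R) : R :=
  s 0%N + \sum_(0 <= i < n) (s i.+1 - s i) * Num.max 0 (Num.min 1 (n%:R * t - i%:R)).

Lemma broken_line_homo t t' : t <= t' -> broken_line t <= broken_line t'.
Proof.
move=> tt; rewrite lerD2l; apply: ler_sum_nat => i /andP[_ ilt].
apply: ler_wpM2l; first by rewrite subr_ge0 s_homo.
apply: le_max2 => //; apply: le_min2 => //.
by rewrite lerD2r ler_wpM2l.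
Qed.

Lemma broken_line_node j : (j <= n)%N -> broken_line (j%:R / n%:R) = s j.
Proof.
move=> jn; have nn : n%:R != 0 :> R by rewrite pnatr_eq0 -lt0n.
rewrite /broken_line (big_cat_nat (n := j))//= [n%:R * _]mulrC divfK//.
have -> : \sum_(0 <= i < j) (s i.+1 - s i) * Num.max 0 (Num.min 1 (j%:R - i%:R)) =
    \sum_(0 <= i < j) (s i.+1 - s i).
  apply: eq_big_nat => i /andP[_ ij]; rewrite min_l ?max_r ?mulr1//.
  by rewrite lerBrDl natr1 ler_nat.
have -> : \sum_(j <= i < n) (s i.+1 - s i) * Num.max 0 (Num.min 1 (j%:R - i%:R)) = 0.
  rewrite big_nat big1// => i /andP[ji _]; rewrite max_l ?mulr0//.
  by rewrite ge_min subr_le0 ler_nat ji orbT.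
by rewrite telescope_sumr// addr0 addrC subrK.
Qed.

Lemma broken_line_continuous : continuous broken_line.
Proof.
have lin i : continuous (fun t : R => n%:R * t - i%:R : R^o).
  by move=> t; apply: cvgB; [exact: mulrl_continuous|exact: cvg_cst].
have clampc i : continuous (fun t : R => Num.max 0 (Num.min 1 (n%:R * t - i%:R)) : R^o).
  move=> t; pose f (t : R) : R^o := n%:R * t - i%:R.
  have c1 : {for t, continuous ((cst 1 : R -> R^o) \min f)}.
    by apply: continuous_min; [exact: cvg_cst|exact: lin].
  have c0 : {for t, continuous (cst 0 : R -> R^o)} by exact: cvg_cst.
  exact: (continuous_max c0 c1).
have sumc : continuous (fun t : R => \sum_(0 <= i < n) (s i.+1 - s i) *
    Num.max 0 (Num.min 1 (n%:R * t - i%:R)) : R^o).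
  apply: (@continuous_big R^o _ +%R 0); first exact: add_continuous.
  by move=> i _ t; apply: cvgZr; exact: clampc.
by move=> t; apply: (@cvgD _ R^o); [exact: cvg_cst|exact: sumc].
Qed.

End broken_line.

Lemma uniform_continuity_seg {R : realType} (f : R -> R) (e : R) :
  {within `[0, 1], continuous f} -> 0 < e ->
  exists2 d, 0 < d & forall s s', 0 <= s <= 1 -> 0 <= s' <= 1 ->
    `|s - s'| < d -> `|f s - f s'| < e.
Proof.
move=> /within_continuous_seg fc e0.
pose P (d s : R) : Prop := forall s' : R, 0 <= s <= 1 -> 0 <= s' <= 1 -> `|s - s'| < d -> `|f s - f s'| < e.
have loc (s : R) : `[0, 1]%classic s -> \forall s' \near s & d \near (0 : R)^'+, P d s'.
  rewrite /= in_itv/= => s01.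
  have e2 : 0 < e / 2 by rewrite divr_gt0.
  have [d d0 dP] := fc s s01 _ e2.
  exists ([set s' | `|s - s'| < d / 2], [set d' : R | d' < d / 2]) => /=.
    split; first by exists (d / 2) => //=; rewrite divr_gt0.
    by apply: nbhs_right_lt; rewrite divr_gt0.
  move=> [s1 d'] /= [s1d d'd] s2 s101 s201 s12.
  have h1 : `|f s - f s1| < e / 2 by apply: dP => //; lra.
  have h2 : `|f s - f s2| < e / 2.
    apply: dP => //.
    by have := ler_distD s1 s s2; lra.
  by have := ler_distD (f s) (f s1) (f s2); rewrite (distrC (f s1) (f s)); lra.
have /compact_near_coveringP/(_ _ _ P (at_right_proper_filter 0) loc) := @segment_compact R 0 1.
move=> H; have [d [d0 dP]] : exists d, 0 < d /\ `[0, 1]%classic `<=` P d.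
  have pf := at_right_proper_filter (0 : R).
  have /filter_ex[d [h1 h2]] := @filterI _ _ pf _ _ H (nbhs_right_gt (0 : R)).
  by exists d.
by exists d => // s s' s01; apply: dP => //=; rewrite in_itv.
Qed.

Section parametric_representations.
Context {R : realType} (T : R).
Hypothesis T0 : 0 < T.
Implicit Types x y z : cadlagM1 T.

(** The order of the completed graph is antisymmetric. *)
Lemma graph_le_anti x p q : completed_graph x p -> completed_graph x q ->
  graph_le x p q -> graph_le x q p -> p = q.
Proof.
case: p q => [z t] [z' t'] [/= tT [c]]; rewrite in_itv/= => c1 zE.
move=> [/= t'T [c']]; rewrite in_itv/= => c'1 z'E.
rewrite /graph_le/=; case=> [|[tt h1]]; first by move=> ? [?|[? _]]; exfalso; lra.
subst t'; case=> [?|[_ h2]]; first by exfalso; lra.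
congr (_, _); have {h1 h2} : `|left_limit x t - z| = `|left_limit x t - z'|.
  by apply/eqP; rewrite eq_le h1.
have dE (d : R) : left_limit x t - (d * left_limit x t + (1 - d) * x t) =
   (1 - d) * (left_limit x t - x t) by ring.
rewrite zE z'E !dE !normrM ger0_norm; last by lra.
rewrite (@ger0_norm _ (1 - c')); last by lra.
have [/eqP|D0] := eqVneq `|left_limit x t - x t| 0.
  by rewrite normr_eq0 subr_eq0 => /eqP ->; move=> _; ring.
by move=> /(mulIf D0) cc; have -> : c = c' by lra.
Qed.

Section rep.
Variables (x : cadlagM1 T) (u r : R -> R).
Hypothesis xur : parametric_rep x u r.

Lemma rep_in s : 0 <= s <= 1 -> completed_graph x (u s, r s).
Proof. by move=> s01; have [_ _ <- _] := xur; exists s => //=; rewrite in_itv. Qed.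

Lemma rep_onto p : completed_graph x p ->
  exists2 s, 0 <= s <= 1 & (u s, r s) = p.
Proof. by have [_ _ <- _] := xur => -[s /= + <-]; rewrite in_itv/=; exists s. Qed.

Lemma rep_le s s' : 0 <= s -> s <= s' -> s' <= 1 ->
  graph_le x (u s, r s) (u s', r s').
Proof.
move=> s0 ss s1; have [_ _ _ h] := xur.
by apply: h => //; rewrite in_itv/=; lra.
Qed.

Lemma rep_time s : 0 <= s <= 1 -> 0 <= r s <= T.
Proof. by move=> /rep_in [/= + _]; rewrite in_itv. Qed.

(** A point of the graph that is between two points of the representation is
    attained between the two parameters: a parameter outside this interval forces
    it to be one of the two points, by antisymmetry. *)
Lemma rep_between s s' q : 0 <= s -> s <= s' -> s' <= 1 -> completed_graph x q ->
  graph_le x (u s, r s) q -> graph_le x q (u s', r s') ->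
  exists c, [/\ s <= c, c <= s' & q = (u c, r c)].
Proof.
move=> s0 ss s1 qG lo hi; have [c /andP[c0 c1] cE] := rep_onto qG.
have sG : completed_graph x (u s, r s) by apply: rep_in; lra.
have s'G : completed_graph x (u s', r s') by apply: rep_in; lra.
have [cs|sc] := ltP c s.
  exists s; split => //; apply: graph_le_anti qG sG _ lo.
  by rewrite -cE; apply: rep_le; lra.
have [s'c|cs'] := ltP s' c.
  exists s'; split => //; apply: graph_le_anti qG s'G hi _.
  by rewrite -cE; apply: rep_le; lra.
by exists c.
Qed.

Lemma rep_ends_neq : (u 0, r 0) <> (u 1, r 1).
Proof.
have gr t : 0 <= t <= T -> completed_graph x (left_limit x t, t).
  move=> tT; split; first by rewrite /= in_itv.
  by exists 1; [rewrite in_itv/= lexx ler01|rewrite /=; ring].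
move=> [_ r01].
have [s s01 [_ sE]] : exists2 s, 0 <= s <= 1 & (u s, r s) = (left_limit x 0, 0).
  by apply/rep_onto/gr; rewrite lexx ltW.
have [s' s'01 [_ s'E]] : exists2 s, 0 <= s <= 1 & (u s, r s) = (left_limit x T, T).
  by apply/rep_onto/gr; rewrite lexx ltW.
have [s0 s1] := andP s01; have [s'0 s'1] := andP s'01.
have := rep_le (lexx 0) s0 s1; have := rep_le s'0 s'1 (lexx 1).
by have := T0; rewrite /graph_le/= sE s'E -r01 => ?; case=> [?|[? _]]; case=> [?|[? _]]; lra.
Qed.

Lemma rep_reparam (lam : R -> R) : continuous lam ->
  {homo lam : s s' / s <= s'} ->
  lam 0 = 0 -> lam 1 = 1 -> parametric_rep x (u \o lam) (r \o lam).
Proof.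
move=> lamc' lamh lam0 lam1; have [uc rc ur urh] := xur.
have lamc : {within `[0, 1], continuous lam} by exact: continuous_subspaceT.
have lam01 s : 0 <= s <= 1 -> 0 <= lam s <= 1.
  by move=> /andP[s0 s1]; rewrite -[X in X <= _ <= _]lam0 -[X in _ <= _ <= X]lam1 !lamh.
have comp (f : R -> R) : {within `[0, 1], continuous f} ->
    {within `[0, 1], continuous (f \o lam)}.
  move=> /within_continuous_seg fc; apply/within_continuous_seg => s s01 e e0.
  have [d d0 dP] := fc _ (lam01 _ s01) e e0.
  have [d' d'0 d'P] := (within_continuous_seg 0 1 lam).1 lamc _ s01 d d0.
  by exists d' => // s' s'01 ss; apply: dP; [exact: lam01|exact: d'P].
split; [exact: comp|exact: comp| |].
- rewrite -ur; apply/seteqP; split => [_ [s /= + <-]|_ [s /= + <-]];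
    rewrite in_itv/= => s01.
    by exists (lam s) => //=; rewrite in_itv; exact: lam01.
  have [|c] := @IVT R lam 0 1 s (ltW ltr01) lamc.
    by rewrite lam0 lam1 min_l ?max_r.
  by rewrite in_itv/= => c01 <-; exists c => //=; rewrite in_itv.
- move=> s1 s2; rewrite !in_itv/= => s101 s201 s12.
  have [h1 h2] := (lam01 _ s101, lam01 _ s201).
  by apply: rep_le; [lra|exact: lamh|lra].
Qed.

End rep.

(** All representations start at the least point of the completed graph. *)
Lemma rep_start x u r u' r' : parametric_rep x u r -> parametric_rep x u' r' ->
  (u 0, r 0) = (u' 0, r' 0).
Proof.
move=> h h'; have z01 : 0 <= (0 : R) <= 1 by lra.
have [s /andP[s0 s1] sE] := rep_onto h (rep_in h' z01).
have [s' /andP[s'0 s'1] s'E] := rep_onto h' (rep_in h z01).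
apply: (graph_le_anti (rep_in h z01) (rep_in h' z01)).
  by rewrite -sE; exact: (rep_le h).
by rewrite -s'E; exact: (rep_le h').
Qed.

(** All representations end at its greatest point. *)
Lemma rep_end x u r u' r' : parametric_rep x u r -> parametric_rep x u' r' ->
  (u 1, r 1) = (u' 1, r' 1).
Proof.
move=> h h'; have z01 : 0 <= (1 : R) <= 1 by lra.
have [s /andP[s0 s1] sE] := rep_onto h (rep_in h' z01).
have [s' /andP[s'0 s'1] s'E] := rep_onto h' (rep_in h z01).
apply: (graph_le_anti (rep_in h z01) (rep_in h' z01)).
  by rewrite -s'E; exact: (rep_le h').
by rewrite -sE; exact: (rep_le h).
Qed.

(** Two representations of the same path are uniformly close after a change of
    parameter [lam] in the first one: [lam] is the broken line that makes them
    agree at the points of a fine subdivision, and both of them stay on the same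
    small arc of the completed graph in between. *)
Lemma rep_equiv x u r u' r' e : parametric_rep x u r -> parametric_rep x u' r' ->
  0 < e -> exists lam : R -> R, [/\ continuous lam,
    {homo lam : s s' / s <= s'}, lam 0 = 0, lam 1 = 1 &
    forall s, 0 <= s <= 1 -> `|u (lam s) - u' s| <= e /\ `|r (lam s) - r' s| <= e].
Proof.
move=> h h' e0.
have [uc' rc' _ _] := h'.
have [d1 d10 d1P] := uniform_continuity_seg uc' e0.
have [d2 d20 d2P] := uniform_continuity_seg rc' e0.
pose d := Num.min d1 d2.
have d0 : 0 < d by rewrite lt_min d10.
have [n nn nd] : exists2 n, (0 < n)%N & n%:R^-1 < d.
  by exists (Num.trunc d^-1).+1 => //; rewrite invf_plt ?posrE ?ltr0n// truncnS_gt.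
have n0 : 0 < n%:R :> R by rewrite ltr0n.
(* [g] is a section of the representation (u, r), normalized at the end points of
   the completed graph so that the change of parameter fixes 0 and 1. *)
have /choice[g gP] : forall p, exists s, completed_graph x p ->
    [/\ 0 <= s <= 1, (u s, r s) = p, p = (u 0, r 0) -> s = 0 &
        p = (u 1, r 1) -> s = 1].
  move=> p; have [pG|] := pselect (completed_graph x p); last by exists 0.
  have [p0|p0] := pselect (p = (u 0, r 0)).
    exists 0 => _; split => //; first by rewrite lexx ler01.
    by move=> p1; case: (rep_ends_neq h); rewrite -p0.
  have [p1|p1] := pselect (p = (u 1, r 1)).
    by exists 1 => _; split => //; rewrite lexx ler01.
  by have [s s01 sE] := rep_onto h pG; exists s.
pose p j := (u' (j%:R / n%:R), r' (j%:R / n%:R)).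
have j01 j : (j <= n)%N -> 0 <= (j%:R / n%:R : R) <= 1.
  by move=> jn; rewrite divr_ge0//= ler_pdivrMr// mul1r ler_nat.
have pG j : (j <= n)%N -> completed_graph x (p j).
  by move=> jn; apply: (rep_in h'); exact: j01.
pose s j := g (p j).
have sh j : (j < n)%N -> s j <= s j.+1.
  move=> jn; have [s1 sE _ _] := gP _ (pG _ (ltnW jn)).
  have [s1' sE' _ _] := gP _ (pG _ jn).
  rewrite leNgt; apply/negP => ss.
  suff pp : p j = p j.+1 by move: ss; rewrite /s pp ltxx.
  apply: (graph_le_anti (pG _ (ltnW jn)) (pG _ jn)).
    have [q0 _] := andP (j01 _ (ltnW jn)); have [_ q1] := andP (j01 _ jn).
    by apply: (rep_le h') => //; rewrite ler_pM2r ?invr_gt0// ler_nat.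
  rewrite -sE -sE'; apply: (rep_le h); [by case/andP: s1'|exact: ltW|by case/andP: s1].
pose lam := broken_line n s.
have lamh t t' : t <= t' -> lam t <= lam t' by exact: broken_line_homo.
have lamn j : (j <= n)%N -> lam (j%:R / n%:R) = s j by exact: broken_line_node.
have lam0 : lam 0 = 0.
  have := lamn 0%N isT; rewrite mul0r => ->.
  have [_ _ + _] := gP _ (pG 0%N isT); apply.
  by rewrite /p mul0r; exact: rep_start h' h.
have lam1 : lam 1 = 1.
  have := lamn n (leqnn n); rewrite divff ?gt_eqF// => ->.
  have [_ _ _] := gP _ (pG n (leqnn n)); apply.
  by rewrite /p divff ?gt_eqF//; exact: rep_end h' h.
have lam01 t : 0 <= t <= 1 -> 0 <= lam t <= 1.
  by move=> /andP[t0 t1]; rewrite -[X in X <= _ <= _]lam0 -[X in _ <= _ <= X]lam1 !lamh.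
exists lam; split => //.
  exact: broken_line_continuous.
move=> t t01; have [t0 t1] := andP t01.
have [j [jn /andP[jt tj]]] : exists j, (j < n)%N /\ j%:R / n%:R <= t <= j.+1%:R / n%:R.
  have [tE|tl] := ltP t 1; last first.
    exists n.-1; split; first by rewrite ltn_predL.
    have -> : t = 1 by lra.
    by rewrite prednK// divff ?gt_eqF// lexx andbT ler_pdivrMr// mul1r ler_nat leq_pred.
  have tn0 : 0 <= t * n%:R by rewrite mulr_ge0// ltW.
  have /andP[h1 h2] := truncn_itv tn0.
  exists (Num.trunc (t * n%:R)); split.
    by rewrite -(ltr_nat R) (le_lt_trans h1)// gtr_pMl.
  by rewrite ler_pdivrMr// h1 ler_pdivlMr// ltW.
(* The point (u, r) (lam t) lies on the graph between [p j] and [p j.+1]. *)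
have [q0 _] := andP (j01 _ (ltnW jn)); have [_ q1] := andP (j01 _ jn).
have q01 : j%:R / n%:R <= j.+1%:R / n%:R :> R by rewrite ler_pM2r ?invr_gt0// ler_nat.
have [[sj01 sjE _ _] [sj'01 sj'E _ _]] := (gP _ (pG _ (ltnW jn)), gP _ (pG _ jn)).
have l1 : s j <= lam t by rewrite -(lamn j (ltnW jn)) lamh.
have l2 : lam t <= s j.+1 by rewrite -(lamn j.+1 jn) lamh.
have [sj0 _] := andP sj01; have [_ sj1] := andP sj'01.
have [lt0 lt1] := andP (lam01 _ t01).
have lo : graph_le x (p j) (u (lam t), r (lam t)).
  by rewrite -sjE; apply: (rep_le h).
have hi : graph_le x (u (lam t), r (lam t)) (p j.+1).
  by rewrite -sj'E; apply: (rep_le h).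
have ltG := rep_in h (lam01 _ t01).
have [c [c1 c2 cE]] := rep_between h' q0 q01 q1 ltG lo hi.
have c01 : 0 <= c <= 1 by lra.
have ct : `|c - t| < d.
  apply: le_lt_trans nd.
  have : j.+1%:R / n%:R = j%:R / n%:R + n%:R^-1 :> R by rewrite -natr1 mulrDl mul1r.
  by rewrite ler_norml; lra.
move: ct; rewrite lt_min => /andP[ct1 ct2].
by case: cE => -> ->; split; apply: ltW; [exact: d1P|exact: d2P].
Qed.

(** The M1 distance without suprema and infima of extended reals. *)
Lemma dist_M1_ltP x y e : (dist_M1 x y < e%:E)%E <->
  exists e' u1 r1 u2 r2, [/\ e' < e, parametric_rep x u1 r1,
    parametric_rep y u2 r2 & forall s, 0 <= s <= 1 ->
      `|u1 s - u2 s| <= e' /\ `|r1 s - r2 s| <= e'].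
Proof.
have sup_le (f g : R -> R) e' : (forall s, 0 <= s <= 1 -> `|f s - g s| <= e') ->
    (sup_dist f g <= e'%:E)%E.
  move=> fg; apply: ge_ereal_sup => _ [s /= + <-]; rewrite in_itv/= => s01.
  by rewrite lee_fin fg.
have le_sup (f g : R -> R) e' : (sup_dist f g <= e'%:E)%E ->
    forall s, 0 <= s <= 1 -> `|f s - g s| <= e'.
  move=> fg s s01; rewrite -lee_fin; apply: le_trans fg.
  by apply: ereal_sup_ubound; exists s => //=; rewrite in_itv.
split.
  move=> /ereal_inf_lt[d [u1 [r1 [u2 [r2 [h1 h2 ->]]]]] de].
  set d' := maxe _ _ in de.
  have d'0 : (0%:E <= d')%E.
    rewrite le_max; apply/orP; left.
    apply: (@le_trans _ _ (`|u1 0 - u2 0|)%:E); first by rewrite lee_fin.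
    by apply: ereal_sup_ubound; exists 0 => //=; rewrite in_itv/= lexx ler01.
  have d'E : d' = (fine d')%:E.
    by rewrite fineK// ge0_fin_numE// (lt_trans de)// ltry.
  exists (fine d'), u1, r1, u2, r2; split => //; first by rewrite -lte_fin -d'E.
  move=> s s01; split; apply: le_sup => //; rewrite -d'E le_max lexx ?orbT//.
move=> [e' [u1 [r1 [u2 [r2 [ee h1 h2 H]]]]]].
apply: (@le_lt_trans _ _ e'%:E); last by rewrite lte_fin.
apply: (@le_trans _ _ (maxe (sup_dist u1 u2) (sup_dist r1 r2))).
  by apply: ereal_inf_lbound; exists u1, r1, u2, r2.
by rewrite ge_max; apply/andP; split; apply: sup_le => s /H [].
Qed.

Lemma dist_M1_triangle x y z a b : (dist_M1 x y < a%:E)%E ->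
  (dist_M1 y z < b%:E)%E -> (dist_M1 x z < (a + b)%:E)%E.
Proof.
move=> /dist_M1_ltP[a' [u1 [r1 [u2 [r2 [aa h1 h2 H]]]]]].
move=> /dist_M1_ltP[b' [u2' [r2' [u3 [r3 [bb h2' h3 H']]]]]].
have e0 : 0 < (a - a') / 2 by rewrite divr_gt0// subr_gt0.
have [lam [lamc lamh lam0 lam1 lamP]] := rep_equiv h2 h2' e0.
apply/dist_M1_ltP; exists (a' + (a - a') / 2 + b'), (u1 \o lam), (r1 \o lam), u3, r3.
split => //; [lra|exact: rep_reparam|].
move=> s s01 /=.
have ls01 : 0 <= lam s <= 1.
  by move: s01 => /andP[s0 s1]; rewrite -[X in X <= _ <= _]lam0 -[X in _ <= _ <= X]lam1 !lamh.
have [hu hr] := H _ ls01; have [hu' hr'] := H' _ s01; have [hl hl'] := lamP _ s01.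
have tri (p q v w : R) : `|p - w| <= `|p - q| + `|q - v| + `|v - w|.
  by apply: (le_trans (ler_distD v p w)); rewrite lerD2r ler_distD.
split.
  by apply: (le_trans (tri _ (u2 (lam s)) (u2' s) _)); lra.
by apply: (le_trans (tri _ (r2 (lam s)) (r2' s) _)); lra.
Qed.

Lemma dist_M1_refl x e : 0 < e -> (dist_M1 x x < e%:E)%E.
Proof.
move=> e0; have [u [r h]] := parametric_rep_exists x T0.
by apply/dist_M1_ltP; exists 0, u, r, u, r; split => // s _; rewrite !subrr normr0.
Qed.

(** By the triangle inequality, open balls are open sets. *)
Lemma nbhs_ball_M1 x e : 0 < e -> nbhs x [set y | (dist_M1 x y < e%:E)%E].
Proof.
move=> e0; apply: open_nbhs_nbhs; split; last exact: dist_M1_refl.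
move=> y /= /[dup] xy /dist_M1_ltP[e' [u1 [r1 [u2 [r2 [ee h1 h2 H]]]]]].
exists ((e - e') / 2); first by rewrite divr_gt0// subr_gt0.
move=> z /= yz.
have -> : e = (e - (e - e') / 2) + (e - e') / 2 by lra.
apply: dist_M1_triangle yz; apply/dist_M1_ltP.
by exists e', u1, r1, u2, r2; split => //; lra.
Qed.

Lemma nbhs_M1P x (A : set (cadlagM1 T)) : nbhs x A ->
  exists2 e, 0 < e & [set y | (dist_M1 x y < e%:E)%E] `<=` A.
Proof.
move=> [B [oB Bx BA]]; have [e e0 eB] := oB x Bx.
by exists e => //; exact: subset_trans eB BA.
Qed.

End parametric_representations.

(** * M1 convergence implies convergence in L^1 *)
Section M1_L1.
Context {R : realType} (T : R).
Local Notation rcbR := (@rcb R R^o T).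
Hypothesis T0 : 0 < T.
Local Notation mu := (@lebesgue_measure R).
Implicit Types x y : cadlagM1 T.

(** A value of [y] is close to a point of the completed graph of [x] at a nearby
    time. *)
Lemma dist_M1_point x y e t : (dist_M1 x y < e%:E)%E -> 0 <= t <= T ->
  exists v c, [/\ 0 <= v <= T, 0 <= c <= 1, `|v - t| < e &
    `|c * left_limit x v + (1 - c) * x v - y t| < e].
Proof.
move=> /dist_M1_ltP[e' [u1 [r1 [u2 [r2 [ee h1 h2 H]]]]]] tT.
have yt : completed_graph y ((y t : R), t).
  split => /=; first by rewrite in_itv.
  by exists 0; [rewrite in_itv/= lexx ler01|ring].
have [s s01 [us rs]] := rep_onto h2 yt.
have [/= vT [c + cE]] := rep_in h1 s01; rewrite in_itv/= => c01.
exists (r1 s), c; have [h3 h4] := H _ s01.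
split => //.
  by rewrite -rs; exact: le_lt_trans ee.
by rewrite -cE -us; exact: le_lt_trans ee.
Qed.

Lemma left_limit_bounded x M : (forall t, 0 <= t <= T -> `|x t| <= M) ->
  forall t, 0 <= t <= T -> `|left_limit x t| <= M.
Proof.
move=> xM t tT; have [t0|t0] := ltP 0 t; last first.
  have -> : t = 0 by lra.
  by rewrite left_limit0; apply: xM; have := T0; lra.
rewrite -[left_limit x t]subr0.
apply: (@left_limit_le _ _ _ x t 0 0) => //; [by rewrite lexx|by case/andP: tT|].
by move=> s /andP[s0 st]; rewrite subr0; apply: xM; lra.
Qed.

Lemma dist_M1_bounded x y M e : (forall t, 0 <= t <= T -> `|x t| <= M) ->
  (dist_M1 x y < e%:E)%E -> forall t, 0 <= t <= T -> `|y t| <= M + e.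
Proof.
move=> xM xy t tT; have [v [c [vT c01 vt]]] := dist_M1_point xy tT.
set p : R := c * _ + _ => pe.
have pM : `|p| <= M.
  rewrite -[p]subr0; apply: (@convex_dist R (left_limit x v)); rewrite ?subr0//; last exact: xM.
  exact: left_limit_bounded.
have := ler_normB p (p - y t); rewrite subKr; lra.
Qed.

Lemma dist_M1_pointwise x t e : 0 < t < T -> left_limit x t = x t -> 0 < e ->
  exists2 d, 0 < d & forall y, (dist_M1 x y < d%:E)%E -> `|x t - y t| <= e.
Proof.
move=> tT jt e0; have e2 : 0 < e / 2 by rewrite divr_gt0.
have [|d1 d10 d1P] := @cadlag_right_window _ _ x t _ _ e2; first lra.
have [|d2 /andP[d20 d2t] d2P] := @cadlag_left_window _ _ x t _ _ e2; first lra.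
pose d := Num.min (e / 2) (Num.min d1 d2).
have [dd1 dd2 de] : [/\ d <= d1, d <= d2 & d <= e / 2].
  by rewrite !ge_min !lexx !orbT.
exists d; first by rewrite !lt_min e2 d10.
move=> y xy; have [|v [c [vT c01 vt]]] := dist_M1_point xy (t := t); first lra.
set p : R := c * _ + _ => pe.
move: vt; rewrite ltr_norml => /andP[vt1 vt2].
have pt : `|p - x t| <= e / 2.
  case: (ltgtP v t) => [vt|tv|vE].
  - have [|h1 h2] := d2P v; first lra.
    by rewrite -jt; exact: (@convex_dist R (left_limit x v)).
  - have [||h1 h2] := d1P v; [lra|lra|].
    exact: (@convex_dist R (left_limit x v)).
  - by apply: (@convex_dist R (left_limit x v)) => //; rewrite vE ?jt subrr normr0 ltW.
have := ler_distD p (x t) (y t); rewrite (distrC (x t) p); lra.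
Qed.

(** By dominated convergence along a sequence of counterexamples: the values
    converge at the continuity points of [x] by [dist_M1_pointwise]. *)
Lemma dist_M1_L1 x e : 0 < e -> exists2 d, 0 < d & forall y,
  (dist_M1 x y < d%:E)%E -> \int[mu]_(s in `[0, T]) `|x s - y s| < e.
Proof.
move=> e0; apply: contrapT => /forall2NP far.
have /choice[y yP] : forall n : nat, exists y, (dist_M1 x y < (n.+1%:R^-1)%:E)%E /\
    e <= \int[mu]_(s in `[0, T]) `|x s - y s|.
  move=> n; have [|/existsNP[y /not_implyP[xy]]] := far (n.+1%:R^-1).
    by rewrite invr_gt0 ltr0n.
  by move=> /negP; rewrite -leNgt => ey; exists y.
pose f n (s : R) : \bar R := (`|x s - y n s|)%:E.
have [M M0 xM] := cadlag_bounded x.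
have fr n : rcbR (fun s => `|x s - y n s|).
  by apply: rcb_norm; apply: rcbB; exact: cadlag_rcb.
have mf n : measurable_fun `[0, T] (f n).
  by apply/measurable_EFinP; apply: rcont_measurable => //; have [] := fr n.
have [tau tauP] := jumps_enum x.
(* The null set of the jump times and of the two end points. *)
pose N : set R := range (fun n => match n with 0 => 0 | 1 => T | k.+2 => tau k end).
have cN : countable N by exact: card_image_le.
have cvg0 : {ae mu, forall s, `[0, T]%classic s -> f ^~ s @ \oo --> 0%E}.
  exists N; split.
  - exact: countable_measurable.
  - exact: countable_lebesgue_measure0.
  move=> s /= /not_implyP[sT nc]; apply: contrapT => sN; apply: nc.
  move: sT; rewrite in_itv/= => sT.
  have s0 : s != 0 by apply/eqP => sE; apply: sN; exists 0%N; rewrite ?sE.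
  have sT' : s != T by apply/eqP => sE; apply: sN; exists 1%N; rewrite ?sE.
  have sT2 : 0 < s < T by rewrite !lt_neqAle eq_sym s0 sT' /=; lra.
  have js : left_limit x s = x s.
    apply/eqP; apply: contrapT => /negP js; apply: sN.
    by have [|n nE] := tauP s _ js; [lra|exists n.+2].
  apply/fine_cvgP; split; first exact: nearW.
  apply/cvgrPdist_le => eps eps0.
  have [d d0 dP] := dist_M1_pointwise sT2 js eps0.
  near=> n; rewrite sub0r normrN /f /= normr_id; apply: dP.
  have [xy _] := yP n; apply: (lt_trans xy); rewrite lte_fin.
  by near: n; exact: (near_infty_natSinv_lt (PosNum d0)).
have dom : {ae mu, forall s n, `[0, T]%classic s -> (`|f n s| <= (M + (M + 1))%:E)%E}.
  apply: aeW => s n; rewrite /= in_itv/= => sT.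
  rewrite lee_fin normr_id; apply: (le_trans (ler_normB _ _)).
  apply: lerD; first exact: xM.
  have [xy _] := yP n; apply: (dist_M1_bounded xM) sT.
  by apply: (lt_le_trans xy); rewrite lee_fin invf_le1 ?ltr0n// ler1n.
have := @dominated_convergence _ _ _ mu `[0, T]%classic _ f (cst 0%E)
  (cst (M + (M + 1))%:E) mf _ cvg0 _ dom.
case=> //; first by apply: (rcb_integrable T0) => //; exact: rcb_cst.
move=> _ _; rewrite integral0 => lim0.
have : \forall n \near \oo, fine (\int[mu]_(s in `[0, T]) f n s) < e.
  have /fine_cvgP[_ /cvgrPdist_lt/(_ _ e0)] := lim0.
  by apply: filterS => n; rewrite sub0r normrN /=; exact/le_lt_trans/ler_norm.
move=> [n _ /(_ n (leqnn n))] /=.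
by have [_] := yP n; rewrite /Rintegral /f; lra.
Unshelve. all: by end_near. Qed.

End M1_L1.

(** * Continuity of the solution map *)
Section add_lipschitz.
Context {R : realType} (T : R).
Hypothesis T0 : 0 < T.

(** Adding a Lipschitz function of time shears the completed graph. *)
Lemma parametric_rep_add (x y : cadlagM1 T) (g : R -> R) B u r :
  @lipT R R^o T B g -> (forall t, 0 <= t <= T -> y t = x t + g t) ->
  parametric_rep x u r -> parametric_rep y (fun s => u s + g (r s)) r.
Proof.
move=> gB yE h; have [uc rc ur urh] := h.
have lE t : 0 <= t <= T -> left_limit y t = left_limit x t + g t.
  by move=> tT; exact: left_limit_add gB yE tT.
have B1 : 0 < `|B| + 1 by rewrite ltr_wpDl.
split => //.
- apply/within_continuous_seg => s s01 e e0.
  have e2 : 0 < e / 2 by rewrite divr_gt0.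
  have [d d0 dP] := (within_continuous_seg 0 1 u).1 uc s s01 _ e2.
  have e3 : 0 < e / 2 / (`|B| + 1) by rewrite divr_gt0.
  have [d' d'0 d'P] := (within_continuous_seg 0 1 r).1 rc s s01 _ e3.
  exists (Num.min d d'); first by rewrite lt_min d0.
  move=> s' s'01; rewrite lt_min => /andP[h1 h2].
  have := dP _ s'01 h1; have := d'P _ s'01 h2.
  rewrite ltr_pdivlMr// => h3 h4.
  have h5 : `|g (r s) - g (r s')| <= `|r s - r s'| * (`|B| + 1).
    apply: (le_trans (gB _ _ (rep_time h s01) (rep_time h s'01))).
    rewrite mulrC ler_wpM2l//; have := ler_norm B; lra.
  have := ler_normD (u s - u s') (g (r s) - g (r s')).
  by rewrite opprD addrACA; lra.
- apply/seteqP; split => [_ [s /= + <-]|[z t] [/= + [c + zE]]].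
    rewrite in_itv/= => s01; have [/= rT [c c01 cE]] := rep_in h s01.
    have rT' := rep_time h s01.
    by split => //=; exists c => //; rewrite lE// yE// cE; ring.
  rewrite in_itv/= => tT c01.
  have [|s s01 [us rs]] := @rep_onto _ _ _ _ _ h (z - g t, t).
    split => /=; first by rewrite in_itv.
    by exists c => //; rewrite zE lE// yE//; ring.
  by exists s; rewrite /= ?in_itv//= us rs subrK.
- move=> s1 s2 s101 s201 s12; case: (urh s1 s2 s101 s201 s12) => [?|/= [rr hr]].
    by left.
  right; split => //=; rewrite in_itv/= in s101.
  have rT := rep_time h s101; rewrite lE//.
  have cancel (a b c : R) : a + c - (b + c) = a - b by ring.
  by rewrite -rr !cancel.
Qed.

(** The two representations are sheared by [g] and [g'], which costs the variation
    of [g] between the two time components and the distance of [g] to [g']. *)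
Lemma dist_M1_add (x x' y y' : cadlagM1 T) (g g' : R -> R) B B' d e :
  @lipT R R^o T B g -> @lipT R R^o T B' g' -> 0 <= B ->
  (forall t, 0 <= t <= T -> y t = x t + g t) ->
  (forall t, 0 <= t <= T -> y' t = x' t + g' t) -> 0 <= e ->
  (forall t, 0 <= t <= T -> `|g t - g' t| <= e) ->
  (dist_M1 x x' < d%:E)%E -> (dist_M1 y y' < (d + B * d + e)%:E)%E.
Proof.
move=> gB g'B B0 yE y'E e0 gg' /dist_M1_ltP[d' [u1 [r1 [u2 [r2 [dd h1 h2 H]]]]]].
apply/dist_M1_ltP; exists (d' + B * d' + e), (fun s => u1 s + g (r1 s)), r1,
  (fun s => u2 s + g' (r2 s)), r2; split.
- by rewrite ltrD2r; apply: ltr_leD => //; rewrite ler_wpM2l// ltW.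
- exact: parametric_rep_add gB yE h1.
- exact: parametric_rep_add g'B y'E h2.
move=> s s01; have [hu hr] := H _ s01.
have d'0 : 0 <= d' by apply: le_trans hu.
have [h3 h4] := (rep_time h1 s01, rep_time h2 s01).
have h5 := gB _ _ h3 h4; have h6 := gg' _ h4.
have h7 : B * `|r1 s - r2 s| <= B * d' by rewrite ler_wpM2l.
have Bd : 0 <= B * d' by rewrite mulr_ge0.
split; last by lra.
have -> : u1 s + g (r1 s) - (u2 s + g' (r2 s)) =
  (u1 s - u2 s) + (g (r1 s) - g (r2 s)) + (g (r2 s) - g' (r2 s)) by ring.
have := ler_normD (u1 s - u2 s + (g (r1 s) - g (r2 s))) (g (r2 s) - g' (r2 s)).
have := ler_normD (u1 s - u2 s) (g (r1 s) - g (r2 s)); lra.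
Qed.

End add_lipschitz.

Section product_topology_lemmas.
Context {R : realType} (m : nat) (T : R).

Lemma coord_path_continuous (i : 'I_m) :
  continuous (fun x : cadlag_prodM1 m T => coord_path x i).
Proof.
move=> x; apply: (@cvg_comp _ _ _ (@coord_paths R m T) (fun f => f i) _
  (nbhs (coord_paths x))); first exact: initial_continuous.
exact: (@proj_continuous _ (fun _ : 'I_m => cadlagM1 T) i).
Qed.

Lemma continuous_coord_path (X : topologicalType) (f : X -> cadlag_prodM1 m T) :
  (forall i : 'I_m, continuous (fun p => coord_path (f p) i)) -> continuous f.
Proof.
move=> fc; apply: (@continuous_comp_initial _ _ _ (@coord_paths R m T) f) => p.
apply/cvg_sup => i U [V /= [[W oW <-] Wp VU]].
apply: filterS VU _; apply: (fc i p).
exact: open_nbhs_nbhs.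
Qed.

End product_topology_lemmas.

Section solution_map.
Context {R : realType} (m : nat) (T : R).
Local Notation rcbR := (@rcb R R^o T).
Hypothesis T0 : 0 < T.
Local Notation mu := (@lebesgue_measure R).
Local Notation D := (cadlag_prodM1 m T).

(** The max norm is bounded by the sum of the absolute values of the coordinates. *)
Lemma Rintegral_norm_coord (z : R -> 'rV[R]_m) : rcb T z ->
  \int[mu]_(s in `[0, T]) `|z s| <=
  \sum_(i < m) \int[mu]_(s in `[0, T]) `|z s 0 i|.
Proof.
move=> zr.
have sumE (r : seq 'I_m) : rcbR (fun s => \sum_(i <- r) `|z s 0 i|) /\
    \int[mu]_(s in `[0, T]) (\sum_(i <- r) `|z s 0 i|) =
    \sum_(i <- r) \int[mu]_(s in `[0, T]) `|z s 0 i|.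
  elim: r => [|i r [IH1 IH2]].
    split; first by under eq_fun do rewrite big_nil; exact: rcb_cst.
    under eq_Rintegral do rewrite big_nil.
    by rewrite big_nil Rintegral_cst_itv ?(ltW T0)// mul0r.
  have zi : rcbR (fun s => `|z s 0 i|) by exact/rcb_norm/rcb_coord.
  split; first by under eq_fun do rewrite big_cons; exact: rcbD.
  under eq_Rintegral do rewrite big_cons.
  by rewrite big_cons -IH2 RintegralD//; exact: (rcb_integrable T0).
have [sr <-] := sumE (index_enum 'I_m).
apply: (Rintegral_le_rcb T0) => //; first exact: rcb_norm.
move=> s _; apply: rV_norm_le => [|i]; first exact: sumr_ge0.
by rewrite (bigD1 i)//= lerDl sumr_ge0.
Qed.

Variable h : 'rV[R]_m -> 'rV[R]_m.
Hypothesis h_lip : forall v : 'rV[R]_m,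
  exists2 U, nbhs v U & [lipschitz h w | w in U].
Variable C : R.
Hypothesis C0 : 0 < C.
Hypothesis hC : forall v, `|h v| <= C * (1 + `|v|).

Lemma cadlag_solution_exists (x : D) : exists y : D, solves T h x y.
Proof.
have [B [g [gB gh]]] := solution_exists T0 h_lip C0 hC (cadlag_rcb x).
have [y yE] := cadlag_add_lip x gB.
exists y => t tT; rewrite yE// gh//; congr (_ + _).
apply: (@eq_vint _ _ T) => [|s sT]; first by case/andP: tT.
by rewrite /= yE.
Qed.

Lemma cadlag_solution_unique (x y y' : D) :
  solves T h x y -> solves T h x y' -> y = y'.
Proof.
move=> yh y'h; apply: cadlag_eq.
by apply: (solution_unique T0 h_lip C0 hC) yh y'h; exact: cadlag_rcb.
Qed.

Lemma solution_map_continuous (phi : D -> D) :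
  (forall x : D, solves T h x (phi x)) -> continuous phi.
Proof.
move=> phiP; apply: (@continuous_coord_path _ _ _ D) => i x A /(nbhs_M1P (x := _))[e e0 eA].
have hc := locally_lipschitz_continuous h_lip.
have [M M0 xM] := cadlag_bounded x.
pose N := 2 * (M + 1 + C * T) * expR (2 * C * T).
have [K K0 hK] := lipschitz_on_ball h_lip N.
have N0 : 0 <= N.
  rewrite mulr_ge0 ?expR_ge0// mulr_ge0// addr_ge0//; first by have := M0; lra.
  by rewrite mulr_ge0// ltW.
have bound (x' : D) : (forall t, 0 <= t <= T -> `|x' t| <= M + 1) ->
    forall t, 0 <= t <= T -> `|phi x' t| <= N.
  move=> x'M; apply: (solution_bound T0 hc C0 hC _ x'M (cadlag_rcb _) (phiP x')).
  by have := M0; lra.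
pose B := C * (1 + N).
have B0 : 0 <= B by rewrite mulr_ge0 ?(ltW C0)// addr_ge0.
have E0 : 0 < expR (2 * K * T) by exact: expR_gt0.
(* The distance [d] makes the shear cost at most e / 4, and the L^1 distance
   [eta] of the coordinates makes sup |g - g'| at most e / 4. *)
pose d := Num.min 1 (e / 4 / (1 + B)).
have d0 : 0 < d by rewrite lt_min ltr01/= divr_gt0// ?divr_gt0// ltr_pwDl.
have dB : d + B * d <= e / 4.
  have -> : d + B * d = d * (1 + B) by ring.
  by rewrite -ler_pdivlMr ?ltr_pwDl// ge_min lexx orbT.
pose eta := e / 4 / (2 * K * expR (2 * K * T) * m.+1%:R).
have KE0 : 0 < 2 * K * expR (2 * K * T) * m.+1%:R by rewrite !mulr_gt0.
have eta0 : 0 < eta by rewrite divr_gt0// divr_gt0.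
(* Two neighbourhoods of [x], uniform in the finitely many coordinates. *)
have near_d : \forall x' \near x, forall j : 'I_m,
    (dist_M1 (coord_path x j) (coord_path x' j) < d%:E)%E.
  apply: (@filter_forall _ _ _ (nbhs x)) => j.
  exact: (@coord_path_continuous _ _ _ j x _ (nbhs_ball_M1 T0 (coord_path x j) d0)).
have near_eta : \forall x' \near x, forall j : 'I_m,
    \int[mu]_(s in `[0, T]) `|x s 0 j - (x' : D) s 0 j| < eta.
  apply: (@filter_forall _ _ _ (nbhs x)) => j.
  have [d' d'0 d'P] := dist_M1_L1 T0 (coord_path x j) eta0.
  have nb := @coord_path_continuous _ _ _ j x _ (nbhs_ball_M1 T0 (coord_path x j) d'0).
  by apply: (@filterS _ (nbhs x) _ _ _ _ nb) => x'; exact: d'P.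
apply: filterS2 near_d near_eta => x' xd xeta; apply: eA => /=.
have x'M t : 0 <= t <= T -> `|x' t| <= M + 1.
  move=> tT; apply: rV_norm_le => [|j]; first by have := M0; lra.
  have xjM s : 0 <= s <= T -> `|coord_path x j s| <= M.
    by move=> sT; apply: le_trans (xM _ sT); exact: rV_coord_le.
  have xd1 : (dist_M1 (coord_path x j) (coord_path x' j) < 1%:E)%E.
    by apply: (lt_le_trans (xd j)); rewrite lee_fin ge_min lexx.
  exact: (dist_M1_bounded T0 xjM xd1 tT).
have xM1 t : 0 <= t <= T -> `|x t| <= M + 1.
  by move=> /xM; lra.
have lip (x0 : D) : (forall t, 0 <= t <= T -> `|x0 t| <= M + 1) ->
    @lipT R R^o T B (fun t => vint (h \o phi x0) t 0 i).
  move=> x0M s t sT tT.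
  have hb r : 0 <= r <= T -> `|(h \o phi x0) r| <= B.
    move=> rT; apply: (le_trans (hC _)); rewrite ler_wpM2l ?(ltW C0)// lerD2l.
    exact: bound.
  have hr := rcb_comp hc (ltW C0) hC (cadlag_rcb (phi x0)).
  apply: le_trans (vint_lip T0 hr hb sT tT).
  have := rV_coord_le (vint (h \o phi x0) s - vint (h \o phi x0) t) i.
  by rewrite !mxE.
have coordE (x0 : D) t : 0 <= t <= T ->
    coord_path (phi x0) i t = coord_path x0 i t + vint (h \o phi x0) t 0 i.
  by move=> tT; rewrite /= (phiP x0 t tT) mxE.
have close t : 0 <= t <= T ->
    `|vint (h \o phi x) t 0 i - vint (h \o phi x') t 0 i| <= e / 4.
  move=> tT.
  have := solution_stability T0 hc C0 hC K0 hK (cadlag_rcb x) (cadlag_rcb x')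
    (cadlag_rcb _) (cadlag_rcb _) (phiP x) (phiP x') (bound _ xM1) (bound _ x'M) tT.
  have := rV_coord_le (vint (h \o phi x) t - vint (h \o phi x') t) i.
  rewrite !mxE => /le_trans h1 /h1 /le_trans; apply.
  have I_le : \int[mu]_(s in `[0, T]) `|x s - x' s| <= eta * m.+1%:R.
    apply: (le_trans (Rintegral_norm_coord (rcbB (cadlag_rcb x) (cadlag_rcb x')))).
    apply: (@le_trans _ _ (\sum_(j < m) eta)).
      apply: ler_sum => j _; apply: ltW; apply: le_lt_trans (xeta j).
      by rewrite le_eqVlt; apply/orP; left; apply/eqP/eq_Rintegral => s _; rewrite !mxE.
    rewrite sumr_const card_ord -[leLHS]mulr_natr ler_wpM2l ?(ltW eta0)//.
    by rewrite ler_nat.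
  have -> : e / 4 = 2 * (K * (eta * m.+1%:R)) * expR (2 * K * T).
    by rewrite /eta; field; rewrite !gt_eqF.
  by rewrite ler_wpM2r ?(ltW E0)// ler_wpM2l// ler_wpM2l// ltW.
have e40 : 0 <= e / 4 by rewrite divr_ge0// ltW.
apply: (lt_le_trans (dist_M1_add (lip x xM1) (lip x' x'M) B0 (coordE x) (coordE x')
  e40 close (xd i))).
by rewrite lee_fin; lra.
Qed.

End solution_map.

Theorem lemma4 (R : realType) (m : nat) (T : R) (h : 'rV[R]_m -> 'rV[R]_m)
    (T_gt0 : 0 < T)
    (h_lip : forall v : 'rV[R]_m,
               exists2 U, nbhs v U & [lipschitz h w | w in U])
    (h_growth : exists C : R, forall v, `|h v| <= C * (1 + `|v|)) :
  exists phi : cadlag_prodM1 m T -> cadlag_prodM1 m T,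
    (forall x y : cadlag_prodM1 m T,
       y = phi x <->
       (forall t, t \in `[0, T] ->
          y t = x t + \row_(i < m) \int[lebesgue_measure]_(s in `[0, t])
                                      h (y s) 0 i)) /\
    continuous phi.
Proof.
have [C0 hC0] := h_growth.
pose C := `|C0| + 1.
have C_gt0 : 0 < C by rewrite ltr_wpDl.
have hC v : `|h v| <= C * (1 + `|v|).
  apply: (le_trans (hC0 v)); rewrite ler_wpM2r ?addr_ge0//.
  by rewrite (le_trans (ler_norm C0))// lerDl.
have /choice[phi phiP] := cadlag_solution_exists T_gt0 h_lip C_gt0 hC.
exists phi; split; last exact: (solution_map_continuous T_gt0 h_lip C_gt0 hC).
move=> x y; split => [-> t|yE]; first by rewrite in_itv/=; exact: phiP.
apply: (cadlag_solution_unique T_gt0 h_lip C_gt0 hC) (phiP x) => t tT.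
by apply: yE; rewrite in_itv.
Qed.
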